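(* Let $d\ge2$ and $t\ge0$ be fixed. For each $m\ge\max\{t,1\}$, let $P_{2^m}=(\boldsymbol x_{\boldsymbol a})_{\boldsymbol a\in\mathbb F_2^m}$ be a digital $(t,m,d)$-net in base $2$. Assume that the family $(P_{2^m})$ satisfies the uniform coincidence bound with a constant $A\ge1$ independent of $m$. Put $N=2^m$. Let $P_{2^m}^{\mathrm{scr}}$ denote either the matrix-scrambled point set $P_{2^m}^{\mathrm{mat},\boldsymbol\delta}$ with a fixed digital shift $\boldsymbol\delta$, or the linearly scrambled point set $P_{2^m}^{\mathrm{lin}}$ (the assertions hold in both cases). There are constants $c,C>0$, depending only on $d,t,A$, such that, for every $m\ge\max\{t,1\}$ and every $u\ge1$ satisfying $u\log N\le N^{1-1/d}$, $$ \mathbb P\left(R_\infty(P_{2^m}^{\mathrm{scr}})<c\,N^{-1/d}(u\log N)^{-1}\ \text{ or }\ \rho_\infty(P_{2^m}^{\mathrm{scr}})>C\,u\log N\right)\le C\,u^{-d}. $$ In particular, as $m\to\infty$, $$ R_\infty(P_{2^m}^{\mathrm{scr}})=\Omega_{\mathbb P}\left(N^{-1/d}(\log N)^{-1}\right), \qquad \rho_\infty(P_{2^m}^{\mathrm{scr}})=O_{\mathbb P}(\log N). $$ The bounds for matrix scrambling are uniform over the fixed shift $\boldsymbol\delta$.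
   Context: Base-2 digital point sets: given generating matrices $C_1,\dots,C_d\in\mathbb F_2^{\mathbb N\times m}$ (finite matrices are extended by zero rows), for $\boldsymbol a\in\mathbb F_2^m$ the point $\boldsymbol x_{\boldsymbol a}$ has $j$-th coordinate $\sum_{r\ge1}y_r2^{-r}$, where $(y_r)_{r\ge1}=C_j\boldsymbol a$ is its specified output digit vector. Membership of a digital point in a dyadic elementary interval is determined by these specified digits. For $\boldsymbol k\in\mathbb N_0^d$, $\mathcal E_{\boldsymbol k}$ is the collection of elementary intervals $\prod_{j=1}^d[a_j2^{-k_j},(a_j+1)2^{-k_j})$, $0\le a_j<2^{k_j}$, and $|\boldsymbol k|=\sum_jk_j$. A digital $(t,m,d)$-net in base 2 is such a point set of $2^m$ points for which every elementary interval of volume $2^{t-m}$ contains exactly $2^t$ points. Uniform coincidence bound with constant $A\ge1$: for every $m$ and all $\boldsymbol k\in\mathbb N_0^d$, $\sum_{E\in\mathcal E_{\boldsymbol k}}\nu_m(E)(\nu_m(E)-1)\le AN(N-1)2^{-|\boldsymbol k|}$, where $N=2^m$ and $\nu_m(E)$ is the number of points of $P_{2^m}$ (with multiplicity) in $E$. Scrambling: for each coordinate $j$ let $L_j$ be a random infinite lower triangular matrix over $\mathbb F_2$ with ones on the diagonal and independent uniform entries below the diagonal, independently over $j$. Given a digital shift $\boldsymbol\delta=(\boldsymbol\delta_1,\dots,\boldsymbol\delta_d)$, $\boldsymbol\delta_j\in\mathbb F_2^{\mathbb N}$, replace the output digit vector $\boldsymbol y$ in coordinate $j$ of every point by $L_j\boldsymbol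 y\oplus\boldsymbol\delta_j$ ($\oplus$ is digitwise addition in $\mathbb F_2$). With $\boldsymbol\delta$ deterministic this is matrix scrambling, giving $P_{2^m}^{\mathrm{mat},\boldsymbol\delta}$ (probability over the matrices only). If all digits of $\boldsymbol\delta$ are independent uniform and independent of the matrices, it is linear scrambling, giving $P_{2^m}^{\mathrm{lin}}$ (probability over matrices and shift). Scrambled coordinates may take the value $1$ for exceptional fixed shifts. For an $N$-point multiset $P=(\boldsymbol x_n)$ in $[0,1]^d$ with $N\ge2$: $R_\infty(P)$ is the minimum of $\|\boldsymbol x_n-\boldsymbol x_{n'}\|_\infty$ over different indices, $h_\infty(P)=\sup_{\boldsymbol z\in[0,1]^d}\min_{n}\|\boldsymbol z-\boldsymbol x_n\|_\infty$, $\rho_\infty(P)=2h_\infty(P)/R_\infty(P)$ ($=\infty$ if $R_\infty(P)=0$). Probabilistic order: $X_m=O_{\mathbb P}(a_m)$ means that for every $\varepsilon>0$ there are $C_\varepsilon>0$ and $m_\varepsilon$ with $\mathbb P(|X_m|>C_\varepsilon a_m)\le\varepsilon$ for all $m\ge m_\varepsilon$; $X_m=\Omega_{\mathbb P}(a_m)$ means $a_m/X_m=O_{\mathbb P}(1)$. *)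

(* Defs.v *)
From HB Require Import structures.
From mathcomp Require Import all_boot all_order all_algebra.
From mathcomp Require Import all_classical all_reals all_analysis.

Set Implicit Arguments.
Unset Strict Implicit.
Unset Printing Implicit Defensive.

Import Order.TTheory GRing.Theory Num.Theory.
Import numFieldNormedType.Exports.

Local Open Scope classical_set_scope.
Local Open Scope ring_scope.

(* Digit positions are counted from 0: position [r] carries weight 2^-(r+1). *)

(* [C j r] is row [r] of the [j]-th generating matrix; a finite matrix is
   completed by zero rows. *)
Definition generators (d m : nat) := 'I_d -> nat -> 'rV['F_2]_m.

Definition digits (d m : nat) (C : generators d m) (a : 'cV['F_2]_m)
  (j : 'I_d) (r : nat) : 'F_2 := (C j r *m a) 0 0.

(* [e] stands for the interval \prod_j [e_j 2^-k_j, (e_j + 1) 2^-k_j).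
   Membership is read off the digits rather than the real value: for digits
   ending in an infinite run of ones the two readings differ. *)
Definition in_elementary (d : nat) (k : 'I_d -> nat)
    (e : {dffun forall j : 'I_d, 'I_(2 ^ k j)}) (y : 'I_d -> nat -> 'F_2)
    : bool :=
  [forall j, (\sum_(r < k j) y j r * 2 ^ (k j - r.+1) == e j)%N].

Definition nu (d m : nat) (C : generators d m) (k : 'I_d -> nat)
    (e : {dffun forall j : 'I_d, 'I_(2 ^ k j)}) : nat :=
  #|[set a : 'cV['F_2]_m | in_elementary e (digits C a)]|.

(* An interval indexed by [k] has volume 2^-(\sum_j k_j), which is 2^(t - m)
   exactly when \sum_j k_j + t = m. *)
Definition digital_net (t m d : nat) (C : generators d m) : Prop :=
  forall (k : 'I_d -> nat) (e : {dffun forall j : 'I_d, 'I_(2 ^ k j)}),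
    (\sum_j k j + t = m)%N -> nu C e = (2 ^ t)%N.

Definition coincidence_bound (R : realType) (d m : nat) (C : generators d m)
    (A : R) : Prop :=
  forall k : 'I_d -> nat,
    \sum_(e : {dffun forall j : 'I_d, 'I_(2 ^ k j)})
      (nu C e)%:R * ((nu C e)%:R - 1)
    <= A * 2 ^+ m * (2 ^+ m - 1) * 2 ^- (\sum_j k j)%N.

Definition unit_lower_triangular (M : nat -> nat -> 'F_2) : Prop :=
  (forall r, M r r = 1) /\ (forall r s, (r < s)%N -> M r s = 0).

(* (M y + delta)_r; the row sum stops at [r] because [M] is only used when it
   is lower triangular. *)
Definition scramble_digits (M : nat -> nat -> 'F_2) (delta : nat -> 'F_2)
    (y : nat -> 'F_2) (r : nat) : 'F_2 :=
  \sum_(s < r.+1) M r s * y s + delta r.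

Definition real_of_digits (R : realType) (y : nat -> 'F_2) : R :=
  limn (series (fun r => (y r : nat)%:R / 2 ^+ r.+1 : R)).

Definition scrambled_points (R : realType) (d m : nat) (C : generators d m)
    (L : 'I_d -> nat -> nat -> 'F_2) (delta : 'I_d -> nat -> 'F_2)
    (a : 'cV['F_2]_m) : 'rV[R]_d :=
  \row_j real_of_digits R (scramble_digits (L j) (delta j) (digits C a j)).

Section Randomness.
Context (R : realType) (disp : measure_display) (Omega : measurableType disp).
Variable P : probability Omega R.

Definition mutually_independent (I : choiceType) (X : I -> Omega -> 'F_2)
    : Prop :=
  forall (J : seq I) (B : I -> set 'F_2), uniq J ->
    P (\bigcap_(i in [set` J]) X i @^-1` B i)
    = (\prod_(i <- J) P (X i @^-1` B i))%E.

Definition uniform_bit (X : Omega -> 'F_2) : Prop :=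
  forall b : 'F_2, P (X @^-1` [set b]) = (2^-1)%:E.

Definition independent_uniform_bits (I : choiceType) (X : I -> Omega -> 'F_2)
    : Prop :=
  [/\ forall (i : I) (B : set 'F_2), measurable (X i @^-1` B),
      mutually_independent X
    & forall i, uniform_bit (X i)].

Definition below_diagonal := {p : nat * nat | (p.2 < p.1)%N}.

Definition below_entry (d : nat) (L : Omega -> 'I_d -> nat -> nat -> 'F_2)
    (p : 'I_d * below_diagonal) (w : Omega) : 'F_2 :=
  L w p.1 (val p.2).1 (val p.2).2.

Definition matrix_scrambling (d : nat)
    (L : Omega -> 'I_d -> nat -> nat -> 'F_2) : Prop :=
  (forall w j, unit_lower_triangular (L w j))
  /\ independent_uniform_bits (below_entry L).

(* One joint family: the shift digits are also independent of the matrices. *)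
Definition linear_scrambling (d : nat)
    (L : Omega -> 'I_d -> nat -> nat -> 'F_2)
    (delta : Omega -> 'I_d -> nat -> 'F_2) : Prop :=
  (forall w j, unit_lower_triangular (L w j))
  /\ independent_uniform_bits
       (fun (i : 'I_d * below_diagonal + 'I_d * nat) (w : Omega) =>
          match i with
          | inl p => below_entry L p w
          | inr q => delta w q.1 q.2
          end).

Definition bigO_prob (X : nat -> Omega -> \bar R) (a : nat -> R) : Prop :=
  forall eps : R, 0 < eps ->
    exists2 K : R, 0 < K & exists m0 : nat, forall m, (m0 <= m)%N ->
      (P [set w | (K * a m)%:E < `|X m w|] <= eps%:E)%E.

(* [bigO_prob] with [K] and [m0] common to all members of a family. *)
Definition unif_bigO_prob (D : Type) (X : D -> nat -> Omega -> \bar R)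
    (a : nat -> R) : Prop :=
  forall eps : R, 0 < eps ->
    exists2 K : R, 0 < K & exists m0 : nat, forall m, (m0 <= m)%N ->
      forall i : D, (P [set w | (K * a m)%:E < `|X i m w|] <= eps%:E)%E.

(* The inverse of 0 in [\bar R] is +oo, as wanted when X_m vanishes. *)
Definition bigOmega_prob (X : nat -> Omega -> \bar R) (a : nat -> R) : Prop :=
  bigO_prob (fun m w => (a m)%:E / X m w)%E (fun=> 1).

Definition unif_bigOmega_prob (D : Type) (X : D -> nat -> Omega -> \bar R)
    (a : nat -> R) : Prop :=
  unif_bigO_prob (fun i m w => (a m)%:E / X i m w)%E (fun=> 1).

End Randomness.

(* On ['rV[R]_d] the norm is the maximum of the absolute values of the
   entries. *)

Definition R_inf (R : realType) (d : nat) (I : finType) (x : I -> 'rV[R]_d)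
    : R :=
  inf [set r | exists i i', i != i' /\ r = `|x i - x i'|].

Definition h_inf (R : realType) (d : nat) (I : finType) (x : I -> 'rV[R]_d)
    : R :=
  sup [set inf [set `|z - x i| | i in [set: I]]
      | z in [set z : 'rV[R]_d | forall j, 0 <= z 0 j <= 1]].

Definition rho_inf (R : realType) (d : nat) (I : finType) (x : I -> 'rV[R]_d)
    : \bar R :=
  if R_inf x == 0 then +oo%E else (2 * h_inf x / R_inf x)%:E.

(* Main.v *)
Require Import Defs.
From HB Require Import structures.
From mathcomp Require Import all_boot all_order all_algebra.
From mathcomp Require Import all_classical all_reals all_analysis.
From mathcomp Require Import measurable_realfun.
From mathcomp Require Import ring lra zify.

Set Implicit Arguments.
Unset Strict Implicit.
Unset Printing Implicit Defensive.

Import Order.TTheory GRing.Theory Num.Theory.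
Import numFieldNormedType.Exports.

Local Open Scope classical_set_scope.
Local Open Scope ring_scope.

(** Two points of a digital net are compared through the difference [b] of their
    indices only: by linearity the digits of the scrambled points at [a] and [a']
    differ exactly where the scrambled digits of [b = a - a'] are one, and the
    digital shift cancels. Hence a union bound runs over the [N - 1] nonzero
    differences instead of the [N^2] pairs; this is where the rate [N^(-1/d)]
    instead of [N^(-2/d)] comes from.

    Fix [b] and a coordinate, and let [k] be the first position where [b] has a
    nonzero digit. The two scrambled coordinates first differ at [k], and they can
    be closer than [2^-n] only through a carry, that is if they also differ at all
    positions between [k] and [n] (lemma [agreeing_digit_gap]). The digit at
    position [r > k] involves the random matrix entry [(r, k)] with coefficient
    one, so these are [n - k - 1] independent fair bits being one
    ([carries_prob], by way of [determined_bits_prob]).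

    The coincidence bound says that at most [A (N - 1) 2^-|k|] nonzero differences
    vanish before [k] in all coordinates ([vanishing_card]). Summing the carry
    probabilities over [b], the powers [2^|k|] cancel and every one of the
    [(n + 1)^d] values of [k] contributes equally ([sum_carry_bound]):
    the separation is below [2^-n] with probability at most
    [A N (2 (n + 1) 2^-n)^d]. For [2^-n] of the order of
    [N^(-1/d) / (u log N)] the size condition on [u] makes [n] of the order of
    [log N], and the bound becomes a constant times [u^-d] ([R_inf_tail]).

    The covering radius needs no probability: scrambling permutes the elementary
    intervals, so the net property puts a point in every almost cubic interval of
    volume [2^t / N], and the radius is at most [2^(t+1) N^(-1/d)] ([h_inf_net],
    [covering_scale]). A large mesh ratio therefore forces a small separation, and
    for a suitable constant the event of the theorem is just the event that the
    separation is small ([scrambled_tail]).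

    Linear scrambling satisfies the assumptions made on matrix scrambling, with a
    random but measurable shift ([linear_scrambling_matrix]), so both cases are
    treated at once. The asymptotic statements fix [u] according to the error
    allowed. They involve the event that the mesh ratio is large by itself, whose
    probability is controlled by monotonicity once it is known to be measurable;
    the supremum over [z] is reduced to rational [z] for this purpose
    ([lt_h_inf_ratP]). *)

(** * Binary expansions *)

Lemma F2_cases (b : 'F_2) : b = 0 \/ b = 1.
Proof. by case: b => [[|[|//]] p]; [left|right]; apply: val_inj. Qed.

Lemma F2_bit (R : realType) (b : 'F_2) : 0 <= ((b : nat)%:R : R) <= 1.
Proof. by case: (F2_cases b) => ->; rewrite /= ?lexx ?ler01. Qed.

Definition digit_term (R : realType) (y : nat -> 'F_2) (r : nat) : R :=
  (y r : nat)%:R / 2 ^+ r.+1.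

Lemma digit_term_ge0 (R : realType) (y : nat -> 'F_2) (r : nat) :
  0 <= digit_term R y r.
Proof. by case/andP: (F2_bit R (y r)) => ? _; rewrite divr_ge0 ?exprn_ge0. Qed.

Lemma digit_series_ndecr (R : realType) (y : nat -> 'F_2) :
  {homo series (digit_term R y) : a b / (a <= b)%N >-> a <= b}.
Proof.
by apply/nondecreasing_seqP => k; rewrite seriesSr lerDl digit_term_ge0.
Qed.

Lemma digit_series_tail (R : realType) (y : nat -> 'F_2) (n k : nat) :
  series (digit_term R y) k <= series (digit_term R y) n + 2^-n.
Proof.
set u := digit_term R y.
have ub i : series u (n + i)%N + 2^-(n + i) <= series u n + 2^-n.
  elim: i => [|i IH]; first by rewrite addn0.
  rewrite addnS seriesSr; apply: le_trans IH.
  rewrite -addrA lerD2l.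
  have -> : (2 ^- (n + i) : R) = 2 ^- (n + i).+1 + 2 ^- (n + i).+1.
    by rewrite exprS; field; rewrite expf_neq0.
  rewrite lerD2r ler_piMl ?invr_ge0 ?exprn_ge0 //.
  by case/andP: (F2_bit R (y (n + i)%N)).
have pos i : 0 <= 2 ^- i :> R by rewrite invr_ge0 exprn_ge0.
have [nk|/ltnW kn] := leqP n k.
  by apply: le_trans (ub (k - n)%N); rewrite subnKC // lerDl.
by apply: le_trans (digit_series_ndecr R y kn) _; rewrite lerDl.
Qed.

Lemma digit_series_cvg (R : realType) (y : nat -> 'F_2) :
  series (digit_term R y) @ \oo --> real_of_digits R y.
Proof.
apply: nondecreasing_is_cvgn; first exact: digit_series_ndecr.
by exists (series (digit_term R y) 0 + 2^-0) => _ [k _ <-]; exact: digit_series_tail.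
Qed.

Lemma real_of_digits_prefix (R : realType) (y : nat -> 'F_2) (n : nat) :
  \sum_(r < n) (y r : nat)%:R / 2 ^+ r.+1 <= real_of_digits R y
    <= \sum_(r < n) (y r : nat)%:R / 2 ^+ r.+1 + 2^-n.
Proof.
have <- : series (digit_term R y) n = \sum_(r < n) (y r : nat)%:R / 2 ^+ r.+1.
  by rewrite seriesEnat /= big_mkord.
have cu : cvgn (series (digit_term R y)) by exact: digit_series_cvg.
apply/andP; split.
  exact: (nondecreasing_cvgn_le (@digit_series_ndecr R y) cu).
by apply: limr_le => //; exists 0%N => // k _; exact: digit_series_tail.
Qed.

(** Before a carry is interrupted the two truncations still differ by at least
    one unit of the last digit read. *)
Lemma digit_sums_gap (R : realType) (y y' : nat -> 'F_2) (k n : nat) :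
  (forall r, (r < k)%N -> y r = y' r) -> y k = 1 -> y' k = 0 -> (k < n)%N ->
  2^-n <= \sum_(r < n) (y r : nat)%:R / 2 ^+ r.+1
        - \sum_(r < n) (y' r : nat)%:R / 2 ^+ r.+1 :> R.
Proof.
move=> eqk yk y'k; elim: n => // n IH; rewrite ltnS leq_eqVlt => /orP[/eqP <-|kn].
  rewrite !big_ord_recr /= yk y'k.
  rewrite (eq_bigr (fun r : 'I_k => (y' r : nat)%:R / 2 ^+ r.+1 : R)) => [|r _].
    by rewrite /= mul0r addr0 mul1r addrAC subrr add0r.
  by rewrite eqk.
rewrite !big_ord_recr /=; have := IH kn.
set a := \sum_(_ < _) _; set b := \sum_(_ < _) _.
have -> : (2 ^- n : R) = 2 ^- n.+1 + 2 ^- n.+1.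
  by rewrite exprS; field; rewrite expf_neq0.
have : 0 <= (2 ^- n.+1 : R) by rewrite invr_ge0 exprn_ge0.
move: (2 ^- n.+1 : R) => e e0 le.
case: (F2_cases (y n)) (F2_cases (y' n)) => -> [] -> /=; rewrite ?mul0r ?mul1r; lra.
Qed.

(** Two numbers whose expansions first differ at [k] can be close only through a
    carry, [1000...] against [0111...], so that the digits differ at every
    following position for a long while; a position [r] where they agree
    interrupts the carry and leaves a gap of one unit of that digit. *)
Lemma agreeing_digit_gap (R : realType) (y y' : nat -> 'F_2) (k r : nat) :
  (forall i, (i < k)%N -> y i = y' i) -> y k != y' k -> (k < r)%N ->
  y r = y' r ->
  2^-r.+1 <= `|real_of_digits R y - real_of_digits R y'|.
Proof.
move=> eqk yk kr yr.
wlog yk1 : y y' eqk yk yr / y k = 1.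
  move=> H; case: (F2_cases (y k)) => [y0|]; last exact: H.
  rewrite distrC; apply: H => [i /eqk||//|]; rewrite 1?eq_sym //.
  by case: (F2_cases (y' k)) yk => -> //; rewrite y0 eqxx.
have yk0 : y' k = 0.
  by case: (F2_cases (y' k)) yk => -> //; rewrite yk1 eqxx.
have := digit_sums_gap R eqk yk1 yk0 kr.
have /andP[+ _] := real_of_digits_prefix R y r.+1.
have /andP[_] := real_of_digits_prefix R y' r.+1.
rewrite !big_ord_recr /= yr.
have -> : (2 ^- r : R) = 2 ^- r.+1 + 2 ^- r.+1.
  by rewrite exprS; field; rewrite expf_neq0.
move=> h1 h2 h3; apply: le_trans (ler_norm _); lra.
Qed.

(** Forward substitution in the triangular system [M y = b + delta]: scrambling
    permutes the prefixes of length [n], hence the dyadic intervals. *)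
Lemma scramble_digits_onto (M : nat -> nat -> 'F_2) (delta b : nat -> 'F_2) n :
  unit_lower_triangular M ->
  exists y, forall r, (r < n)%N -> scramble_digits M delta y r = b r.
Proof.
move=> [M1 M0]; elim: n => [|n [y IH]]; first by exists (fun=> 0).
(* Row [n] has a one on the diagonal, so adding the defect [c] to digit [n]
   corrects that row and leaves the earlier ones alone. *)
pose c := scramble_digits M delta y n + b n.
exists (fun r => if r == n then y n + c else y r) => r.
rewrite ltnS leq_eqVlt => /orP[/eqP ->|rn].
  rewrite /scramble_digits big_ord_recr /= eqxx M1 mul1r.
  rewrite (eq_bigr (fun s : 'I_n => M n s * y s)) => [|s _].
    rewrite addrA (addrAC _ c).
    have -> : \sum_(i < n) M n i * y i + y n + delta n = scramble_digits M delta y n.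
      by rewrite /scramble_digits big_ord_recr /= M1 mul1r.
    rewrite /c addrA; case: (F2_cases (scramble_digits M delta y n)) => ->.
      by rewrite !add0r.
    by case: (F2_cases (b n)) => ->; apply/eqP.
  by rewrite ltn_eqF.
rewrite -(IH r rn) /scramble_digits; congr (_ + _); apply: eq_bigr => s _.
by rewrite ltn_eqF // (leq_ltn_trans _ rn) // -ltnS.
Qed.

(** The shift cancels, which is why every probability below concerns the
    matrices only and is uniform over the shift. *)
Lemma scramble_digits_diff (M : nat -> nat -> 'F_2) (delta y y' : nat -> 'F_2) r :
  scramble_digits M delta y r - scramble_digits M delta y' r
  = scramble_digits M (fun=> 0) (fun s => y s - y' s) r.
Proof.
rewrite /scramble_digits addr0 opprD addrACA subrr addr0 -sumrB.
by apply: eq_bigr => s _; rewrite mulrBr.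
Qed.

Lemma eq_scramble_digits (M : nat -> nat -> 'F_2) (delta y y' : nat -> 'F_2) r :
  (forall s, (s <= r)%N -> y s = y' s) ->
  scramble_digits M delta y r = scramble_digits M delta y' r.
Proof.
by move=> e; congr (_ + _); apply: eq_bigr => s _; rewrite e // -ltnS.
Qed.

(** The error may equal [2^-n]: this happens for [z = 1], which lies in no
    half-open dyadic interval of the unit interval. *)
Lemma dyadic_digits (R : realType) (z : R) (n : nat) : 0 <= z <= 1 ->
  exists b : nat -> 'F_2,
    0 <= z - \sum_(r < n) (b r : nat)%:R / 2 ^+ r.+1 <= 2^-n.
Proof.
move=> z01; elim: n => [|n [b IH]].
  by exists (fun=> 0); rewrite big_ord0 subr0 expr0 invr1.
pose s := \sum_(r < n) (b r : nat)%:R / 2 ^+ r.+1 : R.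
pose c : 'F_2 := if s + 2^-n.+1 <= z then 1 else 0.
exists (fun r => if r == n then c else b r).
rewrite big_ord_recr /= eqxx.
rewrite (eq_bigr (fun r : 'I_n => (b r : nat)%:R / 2 ^+ r.+1 : R)); last first.
  by move=> r _; rewrite ltn_eqF.
move: IH; rewrite -/s /c.
have -> : (2 ^- n : R) = 2 ^- n.+1 + 2 ^- n.+1.
  by rewrite exprS; field; rewrite expf_neq0.
move: (2 ^- n.+1 : R) => e.
by case: (leP (s + e) z) => h /andP[h1 h2]; apply/andP; rewrite /= ?mul0r ?mul1r; split; lra.
Qed.

Lemma dyadic_index_lt (y : nat -> 'F_2) (n : nat) :
  (\sum_(r < n) y r * 2 ^ (n - r.+1) < 2 ^ n)%N.
Proof.
elim: n => [|n IH]; first by rewrite big_ord0.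
rewrite big_ord_recr /= subnn muln1.
rewrite (eq_bigr (fun r : 'I_n => (2 * (y r * 2 ^ (n - r.+1)))%N)) => [|r _].
  rewrite -big_distrr /= expnS.
  have : (y n < 2)%N by case: (F2_cases (y n)) => ->.
  by move: (\sum_(_ < _) _)%N (y n : nat) (2 ^ n)%N IH => a b c; lia.
by rewrite subSn // expnS; lia.
Qed.

Lemma dyadic_index_inj (y y' : nat -> 'F_2) (n : nat) :
  (\sum_(r < n) y r * 2 ^ (n - r.+1) = \sum_(r < n) y' r * 2 ^ (n - r.+1))%N ->
  forall r, (r < n)%N -> y r = y' r.
Proof.
elim: n => // n IH; rewrite !big_ord_recr /= subnn !muln1.
have E (z : nat -> 'F_2) : (\sum_(r < n) z r * 2 ^ (n.+1 - r.+1)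
    = 2 * \sum_(r < n) z r * 2 ^ (n - r.+1))%N.
  rewrite big_distrr /=; apply: eq_bigr => r _.
  by rewrite subSn // expnS; lia.
rewrite !E => e r.
have lt2 (z : nat -> 'F_2) : (z n < 2)%N by case: (F2_cases (z n)) => ->.
have [h1 h2] := (lt2 y, lt2 y').
rewrite ltnS leq_eqVlt => /orP[/eqP ->|rn]; first by apply: val_inj => /=; lia.
by apply: IH => //; lia.
Qed.

(** * Elementary intervals as cosets *)

Lemma digitsB (d m : nat) (C : generators d m) (a a' : 'cV['F_2]_m) j r :
  digits C (a - a') j r = digits C a j r - digits C a' j r.
Proof. by rewrite /digits mulmxBr !mxE. Qed.

Definition box_index (d : nat) (k : 'I_d -> nat) (y : 'I_d -> nat -> 'F_2) :
    {dffun forall j : 'I_d, 'I_(2 ^ k j)} :=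
  [ffun j => Ordinal (dyadic_index_lt (y j) (k j))].

Lemma in_elementaryE (d : nat) (k : 'I_d -> nat) e (y : 'I_d -> nat -> 'F_2) :
  in_elementary e y = (box_index k y == e).
Proof.
apply/forallP/eqP => [ye|<- j]; last by rewrite ffunE.
by apply/ffunP => j; apply: val_inj; rewrite ffunE /= (eqP (ye j)).
Qed.

Lemma box_index_eqP (d : nat) (k : 'I_d -> nat) (y y' : 'I_d -> nat -> 'F_2) :
  reflect (forall j r, (r < k j)%N -> y j r = y' j r)
    (box_index k y == box_index k y').
Proof.
apply: (iffP eqP) => [/ffunP e j|e].
  by have := congr1 val (e j); rewrite !ffunE /=; apply: dyadic_index_inj.
apply/ffunP => j; apply: val_inj; rewrite !ffunE /=.
by apply: eq_bigr => r _; rewrite e.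
Qed.

Lemma nuE (d m : nat) (C : generators d m) (k : 'I_d -> nat) e :
  nu C e = #|[pred a | box_index k (digits C a) == e]|.
Proof.
apply: eq_card => a; rewrite [RHS]inE -in_elementaryE.
by apply/idP/idP => [/set_mem|] //; exact: mem_set.
Qed.

Definition vanishing (d m : nat) (C : generators d m) (k : 'I_d -> nat) :
    {set 'cV['F_2]_m} :=
  [set b | [forall j, [forall r : 'I_(k j), digits C b j r == 0]]].

Lemma vanishingP (d m : nat) (C : generators d m) (k : 'I_d -> nat) b :
  reflect (forall j r, (r < k j)%N -> digits C b j r = 0) (b \in vanishing C k).
Proof.
rewrite inE; apply: (iffP forallP) => [h j r rk|h j].
  by have /forallP/(_ (Ordinal rk))/eqP := h j.
by apply/forallP => r; rewrite h.
Qed.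

(** By linearity the indices of the points of a nonempty elementary interval form
    a coset of the subgroup [vanishing C k] of [F_2^m]. *)
Lemma nu_box (d m : nat) (C : generators d m) (k : 'I_d -> nat) a :
  nu C (box_index k (digits C a)) = #|vanishing C k|.
Proof.
rewrite nuE -(card_imset (mem (vanishing C k)) (addrI a)); apply: eq_card => a'.
rewrite inE; apply/box_index_eqP/imsetP => [e|[b /vanishingP b0 ->] j r rk].
  exists (a' - a); last by rewrite addrC subrK.
  by apply/vanishingP => j r rk; rewrite digitsB e // subrr.
by rewrite -[a in RHS](addrK b) digitsB b0 // subr0.
Qed.

(** All [2^m] points lie in intervals with [#|vanishing C k|] points, so the
    coincidence sum is [2^m (#|vanishing C k| - 1)], and the bound on pairs of
    points becomes one on single differences, smaller by the factor [2^m]. *)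
Lemma vanishing_card (R : realType) (d m : nat) (C : generators d m) (A : R)
    (k : 'I_d -> nat) :
  coincidence_bound C A ->
  (#|vanishing C k|%:R - 1) <= A * (2 ^+ m - 1) * 2 ^- (\sum_j k j)%N.
Proof.
move=> /(_ k).
have -> : \sum_(e : {dffun forall j : 'I_d, 'I_(2 ^ k j)})
    (nu C e)%:R * ((nu C e)%:R - 1) = 2 ^+ m * (#|vanishing C k|%:R - 1) :> R.
  have -> : 2 ^+ m * (#|vanishing C k|%:R - 1) =
      \sum_(a : 'cV['F_2]_m) (#|vanishing C k|%:R - 1) :> R.
    by rewrite sumr_const -[RHS]mulr_natl card_mx card_Fp // muln1 natrX.
  rewrite (partition_big (fun a => box_index k (digits C a)) predT) //=.
  apply: eq_bigr => e _.
  rewrite (eq_bigr (fun=> (nu C e)%:R - 1 : R)) => [|a /eqP <-]; last first.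
    by rewrite nu_box.
  by rewrite sumr_const -[RHS]mulr_natl; congr (_%:R * _); exact: nuE.
have : (0 : R) < 2 ^+ m by rewrite exprn_gt0.
move: (2 ^+ m : R) (2 ^- _ : R) => N e N0.
have -> : A * N * (N - 1) * e = N * (A * (N - 1) * e) by ring.
by rewrite ler_pM2l.
Qed.

Lemma net_prefix (t m d : nat) (C : generators d m) (k : 'I_d -> nat)
    (y : 'I_d -> nat -> 'F_2) :
  digital_net t C -> (\sum_j k j + t = m)%N ->
  exists a, forall j r, (r < k j)%N -> digits C a j r = y j r.
Proof.
move=> /[apply] /(_ (box_index k y)) nu_eq.
have /card_gt0P[a a_in] : (0 < #|[pred a | box_index k (digits C a) == box_index k y]|)%N.
  by rewrite -nuE nu_eq expn_gt0.
move: a_in; rewrite inE => /box_index_eqP e.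
by exists a.
Qed.

(** * Events determined by independent bits *)

Lemma independent_uniform_bits_sub (R : realType) (disp : measure_display)
    (Omega : measurableType disp) (P : probability Omega R) (I I' : choiceType)
    (f : I' -> I) (X : I -> Omega -> 'F_2) (X' : I' -> Omega -> 'F_2) :
  injective f -> (forall i w, X' i w = X (f i) w) ->
  independent_uniform_bits P X -> independent_uniform_bits P X'.
Proof.
move=> f_inj X'E [mX iX uX].
have {X'E} E : X' = X \o f by apply/funext => i; apply/funext.
subst X'; split=> [i B|J B uJ|i b] /=; [exact: mX| |exact: uX].
(* [B' (f j)] is [B j] for [j] in [J], since [f] is injective. *)
pose B' i := [set b | forall j, j \in J -> f j = i -> B j b].
have BE j : j \in J -> B' (f j) = B j.
  move=> jJ; apply/seteqP; split=> b; first exact.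
  by move=> Bb j' j'J /f_inj ->.
have := iX (map f J) B'; rewrite map_inj_uniq // => /(_ uJ).
rewrite big_map (eq_big_seq (fun j => P (X (f j) @^-1` B j))) => [<-|j jJ]; last first.
  by rewrite BE.
congr (P _); apply/seteqP; split=> w h /=.
  by move=> _ /mapP[j jJ ->]; rewrite BE //; exact: h.
by move=> j jJ; have := h _ (map_f f jJ); rewrite BE.
Qed.

Lemma prob_union_le (R : realType) (disp : measure_display)
    (Omega : measurableType disp) (P : probability Omega R) (I : finType)
    (E : set Omega) (F : I -> set Omega) (p : I -> R) :
  measurable E -> (forall i, measurable (F i)) ->
  E `<=` \bigcup_i F i -> (forall i, (P (F i) <= (p i)%:E)%E) ->
  (P E <= (\sum_i p i)%:E)%E.
Proof.
move=> mE mF EF Pp.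
have /(content_sub_fsum P finite_finset) h : forall i, [set: I] i -> measurable (F i) by [].
apply: le_trans (h _ mE EF) _.
have -> : [set: I] = [set` index_enum I].
  by apply/seteqP; split=> i _ //=; rewrite mem_index_enum.
rewrite -fsbig_seq ?index_enum_uniq // -sumEFin.
by apply: lee_sum => i _; exact: Pp.
Qed.

(** If, on [E], the bits indexed by [J] determine those indexed by [K], then
    each of the [2^|J|] values of the former leaves at most one of the
    [2^(|K|+|J|)] equally likely values of the whole family. *)
Lemma determined_bits_prob (R : realType) (disp : measure_display)
    (Omega : measurableType disp) (P : probability Omega R) (K J : finType)
    (X : K + J -> Omega -> 'F_2) (E : set Omega) :
  independent_uniform_bits P X -> measurable E ->
  (forall w w', E w -> E w' -> (forall j, X (inr j) w = X (inr j) w') ->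
    forall k, X (inl k) w = X (inl k) w') ->
  (P E <= (2 ^- #|K|)%:E)%E.
Proof.
move=> [mX iX uX] mE det.
pose V v := \bigcap_(i in [set` enum {: K + J}]) X i @^-1` [set v i].
have mV v : measurable (V v).
  by apply: fin_bigcap_measurable => // i _; exact: mX.
have PV v : P (V v) = (2 ^- (#|K| + #|J|))%:E.
  rewrite /V iX ?enum_uniq // -card_sum cardE.
  elim: (enum _) => [|i s IH]; first by rewrite big_nil expr0 invr1.
  by rewrite big_cons IH uX -EFinM /= exprS invfM.
(* One assignment [v] of all the bits serves the whole fibre over [g]; it is
   read off from any outcome in that fibre. *)
have covers (g : {ffun J -> 'F_2}) : exists v : K + J -> 'F_2,
    forall w, E w -> (forall j, X (inr j) w = g j) -> V v w.
  have [[w0 [Ew0 w0g]]|no] :=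
    pselect (exists w0, E w0 /\ forall j, X (inr j) w0 = g j).
    exists (fun i => X i w0) => w Ew wg [k|j] _ /=.
      by apply: det => // j; rewrite wg w0g.
    by rewrite wg w0g.
  by exists (fun=> 0) => w Ew wg; case: no; exists w.
have [v vP] := choice covers.
apply: (le_trans (@prob_union_le _ _ _ _ _ E (fun g => V (v g))
  (fun=> 2 ^- (#|K| + #|J|)) mE (fun g => mV (v g)) _ _)).
- by move=> w Ew; exists [ffun j => X (inr j) w] => //; apply: vP => // j; rewrite ffunE.
- by move=> g; rewrite PV.
rewrite lee_fin sumr_const card_ffun card_Fp // -[X in X <= _]mulr_natr natrX exprD invfM.
by rewrite -mulrA mulVf ?mulr1 // expf_neq0.
Qed.

Section MeasurableDigits.
Context (disp : measure_display) (Omega : measurableType disp).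

(** Measurability for the discrete sigma-algebra on ['F_2], in the form in which
    the independence hypothesis provides it. *)
Definition measurable_digit (X : Omega -> 'F_2) : Prop :=
  forall B : set 'F_2, measurable (X @^-1` B).

Lemma measurable_digit_cst (b : 'F_2) : measurable_digit (fun=> b).
Proof.
move=> B; have [Bb|nBb] := pselect (B b).
  by rewrite [X in measurable X](_ : _ = setT) //; apply/seteqP; split.
by rewrite [X in measurable X](_ : _ = set0) //; apply/seteqP; split.
Qed.

Lemma measurable_digit2 (op : 'F_2 -> 'F_2 -> 'F_2) (X Y : Omega -> 'F_2) :
  measurable_digit X -> measurable_digit Y ->
  measurable_digit (fun w => op (X w) (Y w)).
Proof.
move=> mX mY B.
rewrite [X in measurable X](_ : _ = \bigcup_(b in [set b | B (op b.1 b.2)])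
    (X @^-1` [set b.1] `&` Y @^-1` [set b.2])).
  apply: fin_bigcup_measurable; first exact: finite_finset.
  by move=> b _; apply: measurableI.
apply/seteqP; split=> [w Bw|w [b Bb [Xb Yb]]]; first by exists (X w, Y w).
by rewrite /preimage /= (Xb : X w = b.1) (Yb : Y w = b.2).
Qed.

Lemma measurable_digit_sum (I : Type) (s : seq I) (X : I -> Omega -> 'F_2) :
  (forall i, measurable_digit (X i)) ->
  measurable_digit (fun w => \sum_(i <- s) X i w).
Proof.
move=> mX; elim: s => [|i s IH].
  rewrite (_ : (fun w => _) = fun=> 0); first exact: measurable_digit_cst.
  by apply/funext => w; rewrite big_nil.
rewrite (_ : (fun w => _) = fun w => X i w + \sum_(i <- s) X i w).
  exact: measurable_digit2.
by apply/funext => w; rewrite big_cons.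
Qed.

Lemma measurable_scramble_digits (M : Omega -> nat -> nat -> 'F_2)
    (delta y : Omega -> nat -> 'F_2) :
  (forall r s, measurable_digit (fun w => M w r s)) ->
  (forall r, measurable_digit (fun w => delta w r)) ->
  (forall r, measurable_digit (fun w => y w r)) ->
  forall r, measurable_digit (fun w => scramble_digits (M w) (delta w) (y w) r).
Proof.
move=> mM md my r; apply: measurable_digit2 => //; apply: measurable_digit_sum => s.
exact: measurable_digit2.
Qed.

Lemma measurable_exists (U : countType) (Q : U -> Omega -> Prop) :
  (forall u, measurable [set w | Q u w]) -> measurable [set w | exists u, Q u w].
Proof.
move=> mQ; rewrite [X in measurable X](_ : _ = \bigcup_u [set w | Q u w]).
  by apply: countable_bigcupT_measurable => //; exact: countableP.
by apply/seteqP; split=> w [u]; [exists u|exists u].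
Qed.

Lemma measurable_forall (U : countType) (Q : U -> Omega -> Prop) :
  (forall u, measurable [set w | Q u w]) -> measurable [set w | forall u, Q u w].
Proof.
move=> mQ; rewrite [X in measurable X](_ : _ = ~` [set w | exists u, ~ Q u w]).
  apply: measurableC; apply: measurable_exists => u.
  by rewrite [X in measurable X](_ : _ = ~` [set w | Q u w]) //; exact: measurableC.
apply/seteqP; split=> w /= h; first by move=> [u]; apply.
by move=> u; apply: contrapT => nQ; apply: h; exists u.
Qed.

Lemma measurable_and_prop (A : Prop) (Q : Omega -> Prop) :
  (A -> measurable [set w | Q w]) -> measurable [set w | A /\ Q w].
Proof.
move=> mQ; have [a|na] := pselect A.
  by rewrite [X in measurable X](_ : _ = [set w | Q w]);
    [exact: mQ|apply/seteqP; split=> w //= -[]].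
by rewrite [X in measurable X](_ : _ = set0) //; apply/seteqP; split=> w // -[].
Qed.

End MeasurableDigits.

(** * Close points and carries *)

(** Capped at [n]: beyond precision [2^-n] the digits do not matter. *)
Definition first_nonzero (n : nat) (y : nat -> 'F_2) : nat :=
  find (fun r => y r != 0) (iota 0 n).

Lemma first_nonzero_le n y : (first_nonzero n y <= n)%N.
Proof. by rewrite -[X in (_ <= X)%N](size_iota 0 n) find_size. Qed.

Lemma before_first_nonzero n y r : (r < first_nonzero n y)%N -> y r = 0.
Proof.
move=> rk; have rn := leq_trans rk (first_nonzero_le n y).
by have /negbFE/eqP := before_find 0%N rk; rewrite nth_iota.
Qed.

Lemma first_nonzeroP n y : (first_nonzero n y < n)%N -> y (first_nonzero n y) = 1.
Proof.
move=> kn; have : has (fun r => y r != 0) (iota 0 n) by rewrite has_find size_iota.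
move=> /(nth_find 0%N); rewrite nth_iota //.
by case: (F2_cases (y (0 + first_nonzero n y)%N)) => [->|]; rewrite ?eqxx.
Qed.

(** To be applied to the digits [z] of a difference of two indices: the scrambled
    digits of the two points then differ at all positions from the first
    difference up to [n], as they must when the points are closer than [2^-n]. *)
Definition carries (d n : nat) (z : 'I_d -> nat -> 'F_2)
    (L : 'I_d -> nat -> nat -> 'F_2) : Prop :=
  forall j r, (first_nonzero n (z j) < r < n)%N ->
    scramble_digits (L j) (fun=> 0) (z j) r = 1.

Lemma scramble_digits_lead (M : nat -> nat -> 'F_2) (y : nat -> 'F_2) k :
  unit_lower_triangular M -> (forall r, (r < k)%N -> y r = 0) ->
  scramble_digits M (fun=> 0) y k = y k.
Proof.
move=> [M1 _] y0; rewrite /scramble_digits big_ord_recr /= M1 mul1r addr0.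
by rewrite big1 ?add0r // => s _; rewrite y0 // mulr0.
Qed.

Lemma coord_le_norm (R : realType) (d : nat) (x : 'rV[R]_d) j : `|x 0 j| <= `|x|.
Proof.
rewrite [X in _ <= X]mx_normrE.
exact: (le_bigmax _ (fun ij : 'I_1 * 'I_d => `|x ij.1 ij.2|) (0, j)).
Qed.

(** By linearity and cancellation of the shift, the scrambled digits of the two
    points differ exactly where the scrambled digits of [a - a'] equal one. *)
Lemma close_points_carry (R : realType) (d m n : nat) (C : generators d m)
    (L : 'I_d -> nat -> nat -> 'F_2) (delta : 'I_d -> nat -> 'F_2) a a' :
  (forall j, unit_lower_triangular (L j)) ->
  `|scrambled_points R C L delta a - scrambled_points R C L delta a'| < 2^-n ->
  carries n (digits C (a - a')) L.
Proof.
move=> Llow close j r /andP[kr rn]; apply: contraTeq close => nc1.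
set z := digits C (a - a') in kr nc1; set k := first_nonzero n (z j) in kr *.
have zE s : z j s = digits C a j s - digits C a' j s by rewrite /z digitsB.
have dE s : scramble_digits (L j) (delta j) (digits C a j) s
    - scramble_digits (L j) (delta j) (digits C a' j) s
    = scramble_digits (L j) (fun=> 0) (z j) s.
  by rewrite scramble_digits_diff; apply: eq_scramble_digits => i _; rewrite zE.
rewrite -leNgt; apply: le_trans (coord_le_norm _ j).
rewrite !mxE; apply: (@le_trans _ _ (2 ^- r.+1)).
  by rewrite lef_pV2 ?posrE ?exprn_gt0 // ler_weXn2l // ler1n.
apply: (@agreeing_digit_gap _ _ _ k) => // [i ik||].
- apply/eqP; rewrite -subr_eq0 dE scramble_digits_lead // => [|s si].
    by rewrite (before_first_nonzero ik).
  by apply: (@before_first_nonzero n); exact: ltn_trans ik.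
- rewrite -subr_eq0 dE scramble_digits_lead // => [|s sk].
    by rewrite first_nonzeroP // (ltn_trans kr).
  exact: (@before_first_nonzero n).
apply/eqP; rewrite -subr_eq0 dE.
by case: (F2_cases (scramble_digits (L j) (fun=> 0) (z j) r)) nc1 => ->; rewrite ?eqxx.
Qed.

Lemma card_ord_above (n k : nat) : (\sum_(r < n) (k < r) = n - k.+1)%N.
Proof. by elim: n => [|n IH]; rewrite ?big_ord0 // big_ord_recr /= IH; lia. Qed.

Section CarryProbability.
Context (R : realType) (disp : measure_display) (Omega : measurableType disp).
Variables (P : probability Omega R) (d : nat).
Variable L : Omega -> 'I_d -> nat -> nat -> 'F_2.
Hypothesis scrL : matrix_scrambling P L.

Lemma measurable_matrix_entry j r s : measurable_digit (fun w => L w j r s).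
Proof.
case: scrL => low [mL _ _] B.
have [sr|rs|->] := ltngtP s r.
- exact: (mL (j, exist (fun p : nat * nat => (p.2 < p.1)%N) (r, s) sr)).
- rewrite (_ : (fun w => _) = fun=> 0); first exact: measurable_digit_cst.
  by apply/funext => w; case: (low w j) => _; apply.
- rewrite (_ : (fun w => _) = fun=> 1); first exact: measurable_digit_cst.
  by apply/funext => w; case: (low w j) => + _; apply.
Qed.

Lemma measurable_carries n z : measurable [set w | carries n z (L w)].
Proof.
rewrite [X in measurable X](_ : _ = [set w | forall p : 'I_d * nat,
    (first_nonzero n (z p.1) < p.2 < n)%N ->
    scramble_digits (L w p.1) (fun=> 0) (z p.1) p.2 = 1]); last first.
  by apply/seteqP; split=> w h; [move=> [j r]; exact: h|move=> j r; exact: (h (j, r))].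
apply: measurable_forall => -[j r] /=.
case: (boolP (_ < _ < _)%N) => _; last first.
  by rewrite [X in measurable X](_ : _ = setT) //; apply/seteqP; split.
rewrite [X in measurable X](_ : _ =
    (fun w => scramble_digits (L w j) (fun=> 0) (z j) r) @^-1` [set 1]); last first.
  by apply/seteqP; split=> w; [exact|move=> + _].
apply: (@measurable_scramble_digits _ _ (fun w => L w j) (fun=> fun=> 0) (fun=> z j)).
- by move=> r' s; exact: measurable_matrix_entry.
- by move=> r'; exact: measurable_digit_cst.
- by move=> r'; exact: measurable_digit_cst.
Qed.

(** With [k] the first nonzero position of [z j], the condition on row [r > k] of
    [L_j] contains the random entry [(r, k)] with coefficient one, so it
    determines that entry from the other ones: one bit for each such row. *)
Lemma carries_prob n z :
  (P [set w | carries n z (L w)]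
   <= (2 ^- (\sum_j (n - (first_nonzero n (z j)).+1))%N)%:E)%E.
Proof.
(* [K] indexes the determined entries [(r, k j)], [J] the other entries below
   the diagonal with row index smaller than [n]. *)
pose k j := first_nonzero n (z j).
pose K := {q : 'I_d * 'I_n | (k q.1 < q.2)%N}.
pose J := {p : 'I_d * ('I_n * 'I_n) | (p.2.2 < p.2.1)%N && (p.2.2 != k p.1 :> nat)}.
have Jlt (p : J) : ((val p).2.2 < (val p).2.1)%N by case/andP: (valP p).
pose f (i : K + J) : 'I_d * below_diagonal := match i with
  | inl q => ((val q).1, exist (fun p : nat * nat => (p.2 < p.1)%N)
      ((val q).2 : nat, k (val q).1) (valP q))
  | inr p => ((val p).1, exist (fun p : nat * nat => (p.2 < p.1)%N)
      ((val p).2.1 : nat, (val p).2.2 : nat) (Jlt p))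
  end.
have f_inj : injective f.
  move=> [[[j r] /= hq]|[[j [r s]] /= hp]] [[[j' r'] /= hq']|[[j' [r' s']] /= hp']] //=.
  - move=> [ej er _]; apply: (congr1 inl); apply: val_inj => /=.
    by rewrite ej; congr (_, _); exact: val_inj.
  - move=> [ej _ es]; case/andP: (hp') => _ /eqP; case.
    by rewrite -es ej.
  - move=> [ej _ es]; case/andP: (hp) => _ /eqP; case.
    by rewrite es ej.
  - move=> [ej er es]; apply: (congr1 inr); apply: val_inj => /=.
    by rewrite ej; congr (_, (_, _)); exact: val_inj.
have cardK : #|{: K}| = (\sum_j (n - (k j).+1))%N.
  rewrite card_sig -sum1_card.
  rewrite (eq_bigl (fun q : 'I_d * 'I_n => true && (k q.1 < q.2)%N)) => [|q] //.
  rewrite -(pair_big_dep xpredT (fun j (r : 'I_n) => (k j < r)%N) (fun _ _ => 1%N)) /=.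
  by apply: eq_bigr => j _; rewrite -card_ord_above big_mkcond.
case: (scrL) => low ind; rewrite -cardK.
have indf := independent_uniform_bits_sub f_inj (fun _ _ => erefl) ind.
apply: (determined_bits_prob indf); first exact: measurable_carries.
move=> w w' cw cw' agree -[[j r] kr] /=; rewrite /below_entry /=.
rewrite /= in kr.
have kn : (k j < n)%N by apply: leq_trans (ltnW (ltn_ord r)).
have krn : (first_nonzero n (z j) < r < n)%N by rewrite kr ltn_ord.
have := cw _ _ krn; rewrite -(cw' _ _ krn) /scramble_digits !addr0.
have kr1 : (k j < r.+1)%N by exact: leqW.
rewrite (bigD1 (Ordinal kr1)) //= [RHS](bigD1 (Ordinal kr1)) //=.
rewrite (first_nonzeroP kn) !mulr1.
(* The remaining terms agree: the diagonal is one, and entries left of the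
   diagonal belong to [J]. *)
rewrite [X in _ + X = _](eq_bigr (fun s : 'I_r.+1 => L w' j r s * z j s)).
  by move/addIr.
move=> s; rewrite -val_eqE /= => sk.
have [s_lt|r_lt|->] := ltngtP s (r : nat).
- have sn : (s < n)%N by apply: ltn_trans (ltn_ord r).
  have h : ((r, Ordinal sn).2 < (r, Ordinal sn).1)%N && (Ordinal sn != k j :> nat).
    by rewrite /= s_lt.
  by have := agree (exist _ (j, (r, Ordinal sn)) h); rewrite /below_entry /= => ->.
- by have := ltn_ord s; lia.
- by case: (low w j) (low w' j) => -> _ [-> _].
Qed.

End CarryProbability.

(** For a single coordinate with first nonzero position [K], the carry
    probability [2^-(n-K-1)] is at most the sum of [2^(k+1-n)] over [k <= K].
    Multiplying over the coordinates and exchanging sums, each [k] in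
    [{0, ..., n}^d] contributes [2^(|k|+d-nd)] times the number of nonzero
    differences vanishing before [k], which is at most [A 2^(m-|k|)]: the factors
    [2^|k|] cancel and only the number [(n+1)^d] of boxes remains. *)
Lemma sum_carry_bound (R : realType) (d m n : nat) (C : generators d m) (A : R) :
  0 <= A -> coincidence_bound C A ->
  \sum_(b : 'cV['F_2]_m | b != 0)
     2 ^- (\sum_j (n - (first_nonzero n (digits C b j)).+1))%N
  <= A * 2 ^+ m * (2 * n.+1%:R * 2^-n) ^+ d.
Proof.
move=> A0 coinc; pose q : R := 2 * 2^-n.
have q0 : 0 <= q by rewrite mulr_ge0 // invr_ge0 exprn_ge0.
pose v b j k := [forall r : 'I_k, digits C b j r == 0].
have term b j : 2 ^- (n - (first_nonzero n (digits C b j)).+1)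
    <= \sum_(k < n.+1) (v b j k)%:R * (2 ^+ k * q).
  set k := first_nonzero n _.
  have kn : (k < n.+1)%N by rewrite ltnS first_nonzero_le.
  rewrite (bigD1 (Ordinal kn)) //= -[X in X <= _]addr0 lerD //; last first.
    by apply: sumr_ge0 => i _; rewrite !mulr_ge0 // exprn_ge0.
  have -> : v b j k.
    by apply/forallP => r; apply/eqP; exact: (@before_first_nonzero n).
  rewrite mul1r /q mulrA -exprSr ler_pdivlMr ?exprn_gt0 //.
  rewrite mulrC ler_pdivrMr ?exprn_gt0 // -exprD ler_weXn2l ?ler1n //; lia.
apply: (@le_trans _ _ (\sum_(b : 'cV['F_2]_m | b != 0)
    \sum_(k : {ffun 'I_d -> 'I_n.+1}) (b \in vanishing C (fun j => k j))%:R
       * (2 ^+ (\sum_j k j)%N * q ^+ d) : R)).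
  apply: ler_sum => b _; rewrite -prodrXr -prodfV.
  apply: (@le_trans _ _ (\prod_j \sum_(k < n.+1) (v b j k)%:R * (2 ^+ k * q) : R)).
    by apply: ler_prod => j _; rewrite invr_ge0 exprn_ge0 //= term.
  rewrite bigA_distr_bigA /=; apply: ler_sum => k _.
  rewrite big_split /= big_split /= prodr_const card_ord prodrXr.
  rewrite -natr_prod; case: (boolP (b \in _)) => [_|].
    rewrite ler_wpM2r ?mulr_ge0 ?exprn_ge0 // lern1.
    by apply: (big_ind (fun x => x <= 1)%N) => // [[|[|x]] [|[|y]]|j _]; rewrite ?leq_b1.
  rewrite inE negb_forall => /existsP[j vj].
  by rewrite (bigD1 j) //= /v (negbTE vj) mul0n !mul0r.
rewrite exchange_big /=.
apply: (@le_trans _ _ (\sum_(k : {ffun 'I_d -> 'I_n.+1}) A * 2 ^+ m * q ^+ d : R)).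
  apply: ler_sum => k _; rewrite -mulr_suml -natr_sum.
  have -> : (\sum_(b : 'cV['F_2]_m | b != 0%R) (b \in vanishing C (fun j => k j))
      = #|vanishing C (fun j => k j)|.-1)%N.
    rewrite (cardsD1 0 (vanishing C (fun j => k j))).
    have -> : 0 \in vanishing C (fun j => k j).
      by apply/vanishingP => j r _; rewrite /digits mulmx0 mxE.
    rewrite add1n /= -sum1_card [RHS]big_mkcond [LHS]big_mkcond /=.
    by apply: eq_bigr => b _; rewrite in_setD1; case: (b == 0) => //=; case: (b \in _).
  have V1 : (0 < #|vanishing C (fun j => k j)|)%N.
    by apply/card_gt0P; exists 0; apply/vanishingP => j r _; rewrite /digits mulmx0 mxE.
  have := vanishing_card (fun j => k j) coinc.
  rewrite -[X in X%:R - 1](prednK V1) -natr1 addrK => le.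
  apply: le_trans (ler_wpM2r _ le) _.
    by rewrite mulr_ge0 ?exprn_ge0.
  rewrite mulrA mulfVK ?expf_neq0 // ler_wpM2r ?exprn_ge0 // ler_wpM2l //.
  by rewrite gerBl.
rewrite sumr_const card_ffun !card_ord -[X in X <= _]mulr_natr natrX -mulrA -exprMn.
by have -> : q * n.+1%:R = 2 * n.+1%:R * 2^-n by rewrite /q mulrAC.
Qed.

(** * Separation and covering radius as measurable functions *)

Lemma R_inf_ltP (R : realType) (d : nat) (I : finType) (x : I -> 'rV[R]_d)
    (i0 i1 : I) (r : R) : i0 != i1 ->
  R_inf x < r <-> exists i i', i != i' /\ `|x i - x i'| < r.
Proof.
move=> i01; split=> [|[i [i' [ii' lt]]]].
  move/inf_lt => [|_ [i [i' [ii' ->]]] lt]; last by exists i, i'.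
  by exists `|x i0 - x i1|, i0, i1.
apply: le_lt_trans lt; apply: ge_inf; last by exists i, i'.
by exists 0 => _ [? [? [_ ->]]].
Qed.

Lemma R_inf_ge0 (R : realType) (d : nat) (I : finType) (x : I -> 'rV[R]_d)
    (i0 i1 : I) : i0 != i1 -> 0 <= R_inf x.
Proof.
move=> i01; rewrite leNgt; apply/negP => /(R_inf_ltP _ _ i01)[i [i' [_]]].
by rewrite ltNge normr_ge0.
Qed.

Lemma lt_inf_finite (R : realType) (I : finType) (f : I -> R) (i0 : I) (s : R) :
  s < inf [set f i | i in [set: I]] <-> forall i, s < f i.
Proof.
split=> [lt i|lt].
  apply: lt_le_trans lt _; apply: ge_inf; last by exists i.
  by exists (f [arg min_(i < i0) f i]%O) => _ [k _ <-]; case: arg_minP => // l _; apply.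
apply: (@lt_le_trans _ _ (f [arg min_(i < i0) f i]%O)) => //.
apply: lb_le_inf; first by exists (f i0), i0.
by move=> _ [k _ <-]; case: arg_minP => // l _; apply.
Qed.

Lemma lt_h_infP (R : realType) (d : nat) (I : finType) (x : I -> 'rV[R]_d)
    (i0 : I) (s : R) :
  s < h_inf x <-> exists z : 'rV[R]_d,
    (forall j, 0 <= z 0 j <= 1) /\ forall i, s < `|z - x i|.
Proof.
split=> [/sup_gt[]|[z [z01 /lt_inf_finite lt]]].
- exists (inf [set `|0 - x i| | i in [set: I]]), 0 => //= j.
  by rewrite mxE lexx ler01.
- by move=> _ [z z01 <-] /lt_inf_finite lt; exists z; split=> //; exact: lt.
apply: lt_le_trans (lt i0) _; apply: ub_le_sup; last by exists z.
exists (1 + `|x i0|) => _ [y y01 <-].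
apply: (@le_trans _ _ `|y - x i0|).
  by apply: ge_inf; [exists 0 => _ [k _ <-]|exists i0].
apply: (le_trans (ler_normB _ _)); rewrite lerD2r [X in X <= _]mx_normrE.
apply/bigmax_leP; split=> // -[u j] _ /=; rewrite ord1.
by have /andP[y0 y1] := y01 j; rewrite ger0_norm.
Qed.

Lemma h_inf_ge0 (R : realType) (d : nat) (I : finType) (x : I -> 'rV[R]_d)
    (i0 : I) : 0 <= h_inf x.
Proof.
rewrite leNgt; apply/negP => h0.
have : h_inf x < h_inf x; last by rewrite ltxx.
apply/(lt_h_infP _ i0); exists 0; split=> [j|i].
  by rewrite mxE lexx ler01.
exact: lt_le_trans h0 _.
Qed.

(** The strict inequalities are open conditions on [z], so a rational [z]
    serves as well; this makes the supremum a countable one. *)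
Lemma lt_h_inf_ratP (R : realType) (d : nat) (I : finType) (x : I -> 'rV[R]_d)
    (i0 : I) (s : R) :
  s < h_inf x <-> exists q : 'rV[rat]_d,
    (forall j, 0 <= (ratr (q 0 j) : R) <= 1)
    /\ forall i, s < `|map_mx ratr q - x i|.
Proof.
split=> [/(lt_h_infP _ i0)[z [z01 lt]]|[q [q01 lt]]]; last first.
  by apply/(lt_h_infP _ i0); exists (map_mx ratr q); split=> // j; rewrite mxE.
have /(lt_inf_finite _ i0) lt_inf := lt.
set e := inf _ in lt_inf; have e0 : 0 < e - s by rewrite subr_gt0.
have near j : exists q : rat,
    0 <= (ratr q : R) <= 1 /\ `|ratr q - z 0 j| < e - s.
  have /andP[z0 z1] := z01 j.
  have : Num.max 0 (z 0 j - (e - s)) < Num.min 1 (z 0 j + (e - s)).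
    by rewrite lt_min !gt_max; apply/andP; split; apply/andP; split; lra.
  move=> /rat_in_itvoo[q]; rewrite in_itv /= lt_min gt_max.
  move=> /andP[/andP[q0 q1] /andP[q2 q3]]; exists q.
  by rewrite (ltW q0) (ltW q2) ltr_norml; split=> //; apply/andP; split; lra.
have [q qP] := choice near.
exists (\row_j q j); split=> [j|i]; first by rewrite mxE; case: (qP j).
have close : `|map_mx ratr (\row_j q j) - z| < e - s.
  rewrite [X in X < _]mx_normrE; apply/bigmax_ltP; split=> // -[u j] _ /=.
  by rewrite !mxE ord1; case: (qP j).
have e_le : e <= `|z - x i|.
  by apply: ge_inf; [exists 0 => _ [k _ <-]|exists i].
have : `|z - x i| <= `|map_mx ratr (\row_j q j) - z|
    + `|map_mx ratr (\row_j q j) - x i|.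
  by rewrite (distrC (map_mx _ _) z); exact: ler_distD.
by move: close e_le; lra.
Qed.

Section MeasurableGeometry.
Context (R : realType) (disp : measure_display) (Omega : measurableType disp).

Lemma measurable_fun_lt_sets (f : Omega -> R) :
  (forall r, measurable [set w | f w < r]) -> measurable_fun setT f.
Proof.
move=> mf mT; apply: (measurability _ (RGenInftyO.measurableE R)) => //.
move=> _ [_ [r ->] <-]; rewrite setTI.
rewrite [X in measurable X](_ : _ = [set w | f w < r]) //.
Qed.

Lemma measurable_fun_gt_sets (f : Omega -> R) :
  (forall r, measurable [set w | r < f w]) -> measurable_fun setT f.
Proof.
move=> mf mT; apply: (measurability _ (RGenOInfty.measurableE R)) => //.
move=> _ [_ [r ->] <-]; rewrite setTI.
rewrite [X in measurable X](_ : _ = [set w | r < f w]) //.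
by apply/seteqP; split=> w /=; rewrite in_itv /= andbT.
Qed.

Lemma measurable_lt_set (f g : Omega -> R) :
  measurable_fun setT f -> measurable_fun setT g ->
  measurable [set w | f w < g w].
Proof.
move=> mf mg; have := measurable_fun_ltr mf mg measurableT (Logic.I : measurable [set true]).
by rewrite setTI.
Qed.

Lemma measurable_real_of_digits (Y : Omega -> nat -> 'F_2) :
  (forall r, measurable_digit (fun w => Y w r)) ->
  measurable_fun setT (fun w => real_of_digits R (Y w)).
Proof.
move=> mY; apply: (@measurable_fun_cvg _ _ _ _
  (fun n w => series (digit_term R (Y w)) n)) => [n|w _]; last exact: digit_series_cvg.
rewrite (_ : (fun w => _) = fun w => \sum_(r <- index_iota 0 n) digit_term R (Y w) r) //.
apply: (@measurable_sum _ _ _ _ _ _ (fun r w => digit_term R (Y w) r)) => r.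
apply: measurable_fun_lt_sets => s.
exact: (mY r (fun b : 'F_2 => (b : nat)%:R / 2 ^+ r.+1 < s)).
Qed.

Lemma measurable_row_norm (d : nat) (v : Omega -> 'rV[R]_d) :
  (forall j, measurable_fun setT (fun w => v w 0 j)) ->
  measurable_fun setT (fun w => `|v w|).
Proof.
move=> mv; rewrite (_ : (fun w => _) = fun w =>
  \big[Num.max/0]_(ij <- index_enum ('I_1 * 'I_d)%type) `|v w ij.1 ij.2|); last first.
  by apply/funext => w; rewrite -mx_normrE.
elim: (index_enum _) => [|[u j] s IH].
  rewrite (_ : (fun w => _) = fun=> 0) //.
  by apply/funext => w; rewrite big_nil.
rewrite (_ : (fun w => _) = fun w => Num.max `|v w 0 j|
  (\big[Num.max/0]_(ij <- s) `|v w ij.1 ij.2|)); last first.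
  by apply/funext => w; rewrite big_cons /= ord1.
apply: measurable_maxr IH; apply: measurableT_comp (mv j).
exact: normr_measurable.
Qed.

Variables (d : nat) (I : finType) (x : Omega -> I -> 'rV[R]_d).
Hypothesis mx : forall i j, measurable_fun setT (fun w => x w i 0 j).

Lemma measurable_R_inf (i0 i1 : I) : i0 != i1 ->
  measurable_fun setT (fun w => R_inf (x w)).
Proof.
move=> i01; apply: measurable_fun_lt_sets => r.
rewrite [X in measurable X](_ : _ = [set w | exists p : I * I,
    p.1 != p.2 /\ `|x w p.1 - x w p.2| < r]); last first.
  apply/seteqP; split=> w /=.
    by move=> /(R_inf_ltP _ _ i01)[i [i' h]]; exists (i, i').
  by move=> [[i i'] h]; apply/(R_inf_ltP _ _ i01); exists i, i'.
apply: measurable_exists => p; apply: measurable_and_prop => _.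
apply: measurable_lt_set => //; apply: measurable_row_norm => j.
rewrite (_ : (fun w => _) = fun w => x w p.1 0 j - x w p.2 0 j).
  exact: measurable_funB.
by apply/funext => w; rewrite !mxE.
Qed.

Lemma measurable_h_inf (i0 : I) : measurable_fun setT (fun w => h_inf (x w)).
Proof.
apply: measurable_fun_gt_sets => s.
rewrite [X in measurable X](_ : _ = [set w | exists q : 'rV[rat]_d,
    (forall j, 0 <= (ratr (q 0 j) : R) <= 1)
    /\ forall i, s < `|map_mx ratr q - x w i|]); last first.
  by apply/seteqP; split=> w /(lt_h_inf_ratP _ i0).
apply: measurable_exists => q; apply: measurable_and_prop => _.
apply: measurable_forall => i.
apply: measurable_lt_set => //; apply: measurable_row_norm => j.
rewrite (_ : (fun w => _) = fun w => ratr (q 0 j) - x w i 0 j).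
  exact: measurable_funB.
by apply/funext => w; rewrite !mxE.
Qed.

(** Written with a product instead of a quotient, the condition needs no case
    distinction on the value of the quotient, only on the sign of [R_inf]. *)
Lemma measurable_rho_inf_gt (i0 i1 : I) (s : R) : i0 != i1 ->
  measurable [set w | (s%:E < rho_inf (x w))%E].
Proof.
move=> i01; have mR := measurable_R_inf i01; have mh := measurable_h_inf i0.
rewrite [X in measurable X](_ : _ = ~` [set w | 0 < R_inf (x w)]
    `|` [set w | s * R_inf (x w) < 2 * h_inf (x w)]).
  apply: measurableU; first by apply/measurableC/measurable_lt_set.
  by apply: measurable_lt_set; exact: measurable_funM.
apply/seteqP; split=> w /=; rewrite /rho_inf.
  case: eqVneq => [->|R0]; first by rewrite ltxx; left.
  rewrite lte_fin ltr_pdivlMr; first by right.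
  by rewrite lt_def R0 (R_inf_ge0 _ i01).
case: eqVneq => [-> _|R0]; first exact: ltry.
have Rpos : 0 < R_inf (x w) by rewrite lt_def R0 (R_inf_ge0 _ i01).
by rewrite lte_fin ltr_pdivlMr // Rpos => -[].
Qed.

End MeasurableGeometry.

(** * The covering radius of a scrambled net *)

Lemma prefix_dist (R : realType) (y : nat -> 'F_2) (b : nat -> 'F_2) (z : R) k :
  (forall r, (r < k)%N -> y r = b r) ->
  0 <= z - \sum_(r < k) (b r : nat)%:R / 2 ^+ r.+1 <= 2^-k ->
  `|z - real_of_digits R y| <= 2^-k.
Proof.
move=> yb /andP[z0 z1]; have /andP[] := real_of_digits_prefix R y k.
rewrite (eq_bigr (fun r : 'I_k => (b r : nat)%:R / 2 ^+ r.+1 : R)) => [|r _].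
  by move=> y0 y1; rewrite ler_norml; apply/andP; split; lra.
by rewrite yb.
Qed.

(** Scrambling permutes the elementary intervals, so each one of volume [2^(t-m)]
    contains, digitwise, a scrambled point. Apply this to an almost cubic interval
    of side lengths at most [2^-floor((m-t)/d)] whose closure contains [z]; a
    point whose digits end in ones is at worst on the boundary, so its distance to
    [z] is still bounded by the side lengths. *)
Lemma h_inf_net (R : realType) (d t m : nat) (C : generators d m)
    (L : 'I_d -> nat -> nat -> 'F_2) (delta : 'I_d -> nat -> 'F_2) :
  (0 < d)%N -> (t <= m)%N -> digital_net t C ->
  (forall j, unit_lower_triangular (L j)) ->
  h_inf (scrambled_points R C L delta) <= 2 ^- ((m - t) %/ d).
Proof.
move=> d0 tm net low; rewrite leNgt; apply/negP.
move=> /(lt_h_infP _ (0 : 'cV['F_2]_m))[z [z01 far]].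
(* The remainder of [m - t] modulo [d] is spread over the first coordinates. *)
pose k (j : 'I_d) := ((m - t) %/ d + (j < (m - t) %% d))%N.
have sum_k : (\sum_j k j + t = m)%N.
  have ind e r : (\sum_(j < e) (j < r) = minn e r)%N.
    by elim: e => [|e IH]; rewrite ?big_ord0 ?min0n // big_ord_recr /= IH; lia.
  rewrite big_split /= sum_nat_const card_ord ind.
  by have := ltn_pmod (m - t) d0; have := divn_eq (m - t) d; lia.
have target j : exists b : nat -> 'F_2,
    0 <= z 0 j - \sum_(r < k j) (b r : nat)%:R / 2 ^+ r.+1 <= 2 ^- k j.
  by apply: dyadic_digits.
have [b bz] := choice target.
have [y yb] := choice (fun j => scramble_digits_onto (delta j) (b j) (k j) (low j)).
have [a ay] := net_prefix y net sum_k.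
have := far a; rewrite ltNge => /negP; apply.
rewrite [X in X <= _]mx_normrE; apply/bigmax_leP; split=> [|[u j] _ /=].
  by rewrite invr_ge0 exprn_ge0.
rewrite !mxE ord1; apply: (@le_trans _ _ (2 ^- k j)).
  apply: prefix_dist (bz j) => r rk; rewrite -yb //.
  by apply: eq_scramble_digits => s sr; apply: ay; exact: leq_ltn_trans rk.
by rewrite lef_pV2 ?posrE ?exprn_gt0 // ler_weXn2l ?ler1n // leq_addr.
Qed.

(** * The probability of a small separation *)

Section CloseProbability.
Context (R : realType) (disp : measure_display) (Omega : measurableType disp).
Variables (P : probability Omega R) (d m : nat) (C : generators d m).
Variables (L : Omega -> 'I_d -> nat -> nat -> 'F_2)
  (delta : Omega -> 'I_d -> nat -> 'F_2).
Hypothesis m_gt0 : (0 < m)%N.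
Hypothesis scrL : matrix_scrambling P L.
Hypothesis mdelta : forall j r, measurable_digit (fun w => delta w j r).
Let x w := scrambled_points R C (L w) (delta w).

Lemma two_columns : (0 : 'cV['F_2]_m) != const_mx 1.
Proof.
by apply/eqP => /matrixP/(_ (Ordinal m_gt0) 0); rewrite !mxE => /eqP; rewrite eq_sym oner_eq0.
Qed.

Lemma measurable_scrambled_coord a j : measurable_fun setT (fun w => x w a 0 j).
Proof.
rewrite (_ : (fun w => _) = fun w => real_of_digits R
    (scramble_digits (L w j) (delta w j) (digits C a j))); last first.
  by apply/funext => w; rewrite mxE.
apply: measurable_real_of_digits => r.
apply: (@measurable_scramble_digits _ _ (fun w => L w j) (fun w => delta w j)
  (fun=> digits C a j)) => [r' s|//|r'].
  exact: (measurable_matrix_entry scrL).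
exact: measurable_digit_cst.
Qed.

Lemma measurable_R_inf_scrambled : measurable_fun setT (fun w => R_inf (x w)).
Proof. by apply: measurable_R_inf two_columns; exact: measurable_scrambled_coord. Qed.

Lemma measurable_rho_inf_scrambled (s : R) :
  measurable [set w | (s%:E < rho_inf (x w))%E].
Proof. by apply: measurable_rho_inf_gt two_columns; exact: measurable_scrambled_coord. Qed.

(** A union bound over the [2^m - 1] differences, rather than over the pairs of
    points: the carry condition sees a pair only through its difference. *)
Lemma R_inf_small_prob (A r : R) (n : nat) :
  0 <= A -> coincidence_bound C A -> r <= 2^-n ->
  (P [set w | (R_inf (x w) < r)%R]
   <= (A * 2 ^+ m * (2 * n.+1%:R * 2^-n) ^+ d)%:E)%E.
Proof.
move=> A0 coinc rn.
pose F b := [set w | b != 0 /\ carries n (digits C b) (L w)].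
pose p (b : 'cV['F_2]_m) : R := if b != 0 then
  2 ^- (\sum_j (n - (first_nonzero n (digits C b j)).+1))%N else 0.
apply: (@le_trans _ _ (\sum_b p b)%:E); last first.
  by rewrite lee_fin -big_mkcond; exact: sum_carry_bound.
apply: (@prob_union_le _ _ _ _ _ _ F).
- by apply: measurable_lt_set => //; exact: measurable_R_inf_scrambled.
- by move=> b; apply: measurable_and_prop => _; exact: (measurable_carries scrL).
- move=> w /(R_inf_ltP _ _ two_columns)[a [a' [aa' close]]].
  exists (a - a') => //; split; first by rewrite subr_eq0.
  apply: (@close_points_carry R _ _ _ _ _ (delta w)); first by case: scrL.
  exact: lt_le_trans close rn.
- move=> b; rewrite /F /p; case: eqVneq => b0 /=.
    by rewrite [X in P X](_ : _ = set0) ?measure0 //; apply/seteqP; split=> w // -[].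
  rewrite [X in P X](_ : _ = [set w | carries n (digits C b) (L w)]).
    exact: (carries_prob scrL).
  by apply/seteqP; split=> w //= -[].
Qed.

End CloseProbability.

(** * Choice of scales *)

Lemma ln2_ge (R : realType) : 2^-1 <= ln 2 :> R.
Proof.
rewrite -[X in X <= _]expRK ler_ln ?posrE ?expR_gt0 //.
have := expR_ge1Dx (- 2^-1 : R); rewrite expRN => h.
have e0 := expR_gt0 (2^-1 : R).
by have := ler_wpM2l (ltW e0) h; rewrite mulfV ?gt_eqF //; lra.
Qed.

Section Scales.
Variables (R : realType) (d m : nat).
Hypotheses (d_gt0 : (0 < d)%N) (m_gt0 : (0 < m)%N).
Let N : R := 2 ^+ m.
Let s : R := N `^ (- d%:R^-1).

Let N_gt0 : 0 < N. Proof. by rewrite exprn_gt0. Qed.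
Let s_gt0 : 0 < s. Proof. exact: powR_gt0. Qed.

Lemma ln_pow2 : ln N = m%:R * ln 2.
Proof. by rewrite /N lnXn // mulr_natl. Qed.

Lemma ln_pow2_gt0 : 0 < ln N.
Proof.
by rewrite ln_pow2 mulr_gt0 ?ltr0n //; apply: lt_le_trans (ln2_ge R); rewrite invr_gt0.
Qed.

Lemma root_pow : s ^+ d = N^-1.
Proof.
rewrite -powR_mulrn ?ltW // /s -powRrM mulNr mulVf ?pnatr_eq0 ?lt0n_neq0 //.
by rewrite powR_inv1 // ltW.
Qed.

Lemma root_split : N `^ (1 - d%:R^-1) = N * s.
Proof.
rewrite powRD; first by rewrite powRr1 // ltW.
by apply/implyP => _; rewrite gt_eqF.
Qed.

(** Rounds the threshold [r] up to a dyadic scale. The size condition on [u] gives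
    [r >= 1 / (2 N)], which keeps the number [n] of relevant digits of the order
    of [log N]; the logarithm in the theorem comes from this [n]. *)
Lemma dyadic_scale (u r : R) : 1 <= u -> u * ln N <= N `^ (1 - d%:R^-1) ->
  r = 2^-1 * s * (u * ln N)^-1 ->
  exists n, [/\ r <= 2^-n, 2^-n <= 2 * r & (n <= m.+1)%N].
Proof.
move=> u1 small rE; have l0 := ln_pow2_gt0.
have ul0 : 0 < u * ln N by rewrite mulr_gt0 // (lt_le_trans _ u1).
have r0 : 0 < r by rewrite rE !mulr_gt0 // invr_gt0.
have rN : (2 * N)^-1 <= r.
  rewrite rE invfM -mulrA ler_pM2l ?invr_gt0 // ler_pdivlMr //.
  by rewrite mulrC ler_pdivrMr // (mulrC s) -root_split.
have r1 : r <= 1.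
  have s1 : s <= 1.
    rewrite -(@ler_pXn2r _ d) ?nnegrE ?(ltW s_gt0) // root_pow expr1n invf_le1 //.
    by rewrite exprn_ege1 ?ler1n.
  have ulge : 2^-1 <= u * ln N.
    have ln2_ge0 : 0 <= ln 2 :> R by apply: le_trans (ln2_ge R); rewrite invr_ge0.
    apply: (le_trans (ln2_ge R)); rewrite ln_pow2 mulrA ler_peMl //.
    by rewrite -[X in X <= _]mulr1 ler_pM ?ler1n.
  by rewrite rE ler_pdivrMr // mul1r; apply: le_trans ulge; rewrite ler_piMr.
pose T := Num.truncn r^-1; have T0 : (0 < T)%N by rewrite truncn_gt0 invf_ge1.
have /andP[lo hi] := @trunc_log_bounds 2 T isT T0.
have loR : 2 ^+ (trunc_log 2 T) <= r^-1.
  apply: (@le_trans _ _ T%:R); first by rewrite -natrX ler_nat.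
  by rewrite truncn_le invr_ge0 ltW.
have hiR : r^-1 <= 2 ^+ (trunc_log 2 T).+1.
  apply: (@le_trans _ _ T.+1%:R); last by rewrite -natrX ler_nat.
  exact/ltW/truncnS_gt.
exists (trunc_log 2 T); split.
- by rewrite -[r]invrK lef_pV2 ?posrE ?invr_gt0 ?exprn_gt0.
- rewrite -[r]invrK -ler_pdivrMl // -invfM -exprS lef_pV2 ?posrE ?exprn_gt0 ?invr_gt0 //.
- rewrite -(@ler_eXn2l R 2) ?ltr1n //; apply: (le_trans loR).
  by rewrite exprS -[X in _ <= X]invrK lef_pV2 ?posrE ?invr_gt0 ?mulr_gt0.
Qed.

Lemma covering_scale (t : nat) : 2 ^- ((m - t) %/ d) <= 2 ^+ t.+1 * s.
Proof.
set q := ((m - t) %/ d)%N.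
have s0 := ltW s_gt0.
rewrite -(@ler_pXn2r _ d) ?nnegrE ?invr_ge0 ?exprn_ge0 ?mulr_ge0 ?exprn_ge0 //.
rewrite exprMn root_pow exprVn -!exprM ler_pdivlMr // ler_pdivrMl ?exprn_gt0 //.
rewrite -exprD ler_weXn2l ?ler1n //.
have := ltn_ceil (m - t) d_gt0; rewrite -/q.
by have : (t <= t * d)%N; [exact: leq_pmulr|nia].
Qed.

End Scales.

(** * Tail bounds *)

Section Tails.
Context (R : realType) (disp : measure_display) (Omega : measurableType disp).
Variables (P : probability Omega R) (d t m : nat) (C : generators d m) (A : R).
Hypotheses (d_gt0 : (0 < d)%N) (m_ge : (maxn t 1 <= m)%N) (A_ge0 : 0 <= A).
Hypothesis net : digital_net t C.
Hypothesis coinc : coincidence_bound C A.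
Let N : R := 2 ^+ m.
Let s : R := N `^ (- d%:R^-1).

Let m_gt0 : (0 < m)%N. Proof. by move: m_ge; rewrite geq_max => /andP[]. Qed.
Let t_le : (t <= m)%N. Proof. by move: m_ge; rewrite geq_max => /andP[]. Qed.

(** With [2^-n <= 2 r] the bound on the probability is
    [A N (2 (n+1) 2^-n)^d <= A N (2 (n+1) s / (u ln N))^d], where [s^d = 1/N], and
    [n + 1 <= 3 m <= 6 ln N] because [ln 2 >= 1/2]; this gives the constant 12. *)
Lemma R_inf_tail (L : Omega -> 'I_d -> nat -> nat -> 'F_2)
    (delta : Omega -> 'I_d -> nat -> 'F_2) (u : R) :
  matrix_scrambling P L ->
  (forall j r, measurable_digit (fun w => delta w j r)) ->
  1 <= u -> u * ln N <= N `^ (1 - d%:R^-1) ->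
  (P [set w | (R_inf (scrambled_points R C (L w) (delta w))
                < 2^-1 * s * (u * ln N)^-1)%R]
   <= (A * 12 ^+ d * u ^- d)%:E)%E.
Proof.
move=> scrL mdelta u1 small.
have [n [rn nr nm]] := dyadic_scale d_gt0 m_gt0 u1 small erefl.
apply: le_trans (R_inf_small_prob m_gt0 scrL mdelta A_ge0 coinc rn) _.
have u0 : 0 < u by exact: lt_le_trans u1.
have l0 := @ln_pow2_gt0 R m m_gt0.
have s0 : 0 < s by apply: powR_gt0; rewrite exprn_gt0.
rewrite lee_fin -!mulrA ler_wpM2l // -/N.
have N0 : 0 < N by rewrite exprn_gt0.
rewrite -ler_pdivlMl // -(@root_pow R d m d_gt0) -/N -/s -(exprVn u) -!exprMn.
have [s0' l0' u0'] : [/\ 0 <= s, 0 <= ln N & 0 <= u] by split; exact: ltW.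
rewrite lerXn2r ?nnegrE ?mulr_ge0 ?invr_ge0 ?exprn_ge0 //.
have n1 : n.+1%:R <= 3 * m%:R :> R by rewrite -natrM ler_nat; lia.
have l2 : m%:R <= 2 * ln N.
  have := ln2_ge R; rewrite ln_pow2 // => h.
  rewrite mulrCA ler_peMr ?ler0n //; lra.
have nl : n.+1%:R <= 6 * ln N by lra.
apply: (@le_trans _ _ (2 * (n.+1%:R * (2 * (2^-1 * s * (u * ln N)^-1))))).
  by rewrite !ler_wpM2l.
have -> : 2 * (n.+1%:R * (2 * (2^-1 * s * (u * ln N)^-1)))
    = s * (n.+1%:R * 2 / ln N / u).
  by field; rewrite ?gt_eqF.
rewrite ler_pM2l // ler_pM2r ?invr_gt0 // ler_pdivrMr //; lra.
Qed.

(** The covering radius is always at most [2^(t+1) N^(-1/d)], so the mesh ratio can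
    only be large when the separation is small. *)
Lemma rho_inf_tail (L : 'I_d -> nat -> nat -> 'F_2)
    (delta : 'I_d -> nat -> 'F_2) (K u : R) :
  (forall j, unit_lower_triangular (L j)) -> 0 < u -> 2 ^+ t.+3 <= K ->
  2^-1 * s * (u * ln N)^-1 <= R_inf (scrambled_points R C L delta) ->
  (rho_inf (scrambled_points R C L delta) <= (K * u * ln N)%:E)%E.
Proof.
move=> low u0 KE; rewrite /rho_inf; set h := h_inf _; set r := R_inf _ => rr.
have l0 := @ln_pow2_gt0 R m m_gt0.
have s0 : 0 < s by apply: powR_gt0; rewrite exprn_gt0.
have ul0 : 0 < u * ln N by rewrite mulr_gt0.
have r0 : 0 < r by apply: lt_le_trans rr; rewrite !mulr_gt0 ?invr_gt0.
rewrite gt_eqF // lee_fin ler_pdivrMr //.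
have hs : h <= 2 ^+ t.+1 * s.
  exact: le_trans (h_inf_net R delta d_gt0 t_le net low) (covering_scale R d_gt0 m_gt0 t).
apply: (@le_trans _ _ (K * u * ln N * (2^-1 * s * (u * ln N)^-1))); last first.
  rewrite ler_wpM2l // -mulrA mulr_ge0 ?ltW //.
  by apply: lt_le_trans KE; rewrite exprn_gt0.
have -> : K * u * ln N * (2^-1 * s * (u * ln N)^-1) = K / 2 * s.
  by field; rewrite ?gt_eqF.
apply: (@le_trans _ _ (2 * (2 ^+ t.+1 * s))); first by rewrite ler_wpM2l.
rewrite mulrA ler_wpM2r ?(ltW s0) // ler_pdivlMr //.
by apply: le_trans KE; rewrite !exprS; lra.
Qed.

Lemma scrambled_tail (L : Omega -> 'I_d -> nat -> nat -> 'F_2)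
    (delta : Omega -> 'I_d -> nat -> 'F_2) (K u : R) :
  matrix_scrambling P L ->
  (forall j r, measurable_digit (fun w => delta w j r)) ->
  1 <= u -> u * ln N <= N `^ (1 - d%:R^-1) ->
  2 ^+ t.+3 + A * 12 ^+ d <= K ->
  (P [set w | (R_inf (scrambled_points R C (L w) (delta w))
                < 2^-1 * s * (u * ln N)^-1)%R
              \/ ((K * u * ln N)%:E
                < rho_inf (scrambled_points R C (L w) (delta w)))%E]
   <= (K * u ^- d)%:E)%E.
Proof.
move=> scrL mdelta u1 small KE.
pose x w := scrambled_points R C (L w) (delta w).
have u0 : 0 < u by exact: lt_le_trans u1.
have t3 : 0 <= 2 ^+ t.+3 :> R by rewrite exprn_ge0.
have A12 : 0 <= A * 12 ^+ d by rewrite mulr_ge0 ?exprn_ge0.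
rewrite [X in P X](_ : _ = [set w | R_inf (x w) < 2^-1 * s * (u * ln N)^-1]).
  apply: le_trans (R_inf_tail scrL mdelta u1 small) _.
  by rewrite lee_fin ler_wpM2r ?invr_ge0 ?exprn_ge0 ?(ltW u0) //; lra.
apply/seteqP; split=> w /=; last by left.
case=> // big; rewrite ltNge; apply/negP => rr; move: big; apply/negP; rewrite -leNgt.
by apply: rho_inf_tail => //; [case: scrL|lra].
Qed.

End Tails.

(** * From linear to matrix scrambling, and asymptotics *)

Lemma linear_scrambling_matrix (R : realType) (disp : measure_display)
    (Omega : measurableType disp) (P : probability Omega R) (d : nat)
    (L : Omega -> 'I_d -> nat -> nat -> 'F_2)
    (delta : Omega -> 'I_d -> nat -> 'F_2) :
  linear_scrambling P L delta ->
  matrix_scrambling P L /\ forall j r, measurable_digit (fun w => delta w j r).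
Proof.
move=> [low ind]; split; first split=> //.
  have inl_inj : injective (@inl ('I_d * below_diagonal) ('I_d * nat)) by move=> ? ? [].
  exact: (independent_uniform_bits_sub inl_inj (fun _ _ => erefl) ind).
by move=> j r B; case: ind => /(_ (inr (j, r)) B).
Qed.

(** For fixed [u] the size condition holds for all large [m], because
    [ln N = 4 ln N^(1/4) <= 4 N^(1/4)] while [N^(1-1/d) >= N^(1/2)]. *)
Lemma eventually_small (R : realType) (d t : nat) (u : R) : (2 <= d)%N -> 0 <= u ->
  exists m0, forall m, (m0 <= m)%N -> (maxn t 1 <= m)%N
    /\ u * ln (2 ^+ m) <= (2 ^+ m) `^ (1 - d%:R^-1).
Proof.
move=> hd u0; pose K := Num.truncn ((4 * u) ^+ 4).
exists (maxn (maxn t 1) K.+1) => m; rewrite geq_max => /andP[mt mK]; split=> //.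
set N : R := 2 ^+ m.
have N1 : 1 <= N by rewrite exprn_ege1 ?ler1n.
have N0 : 0 < N by exact: lt_le_trans N1.
pose v := N `^ 4^-1.
have v0 : 0 < v by exact: powR_gt0.
have v4 : v ^+ 4 = N by rewrite -powR_mulrn ?ltW // /v -powRrM mulVf // powRr1 ?ltW.
have uv : 4 * u <= v.
  rewrite -(@ler_pXn2r _ 4) ?nnegrE ?mulr_ge0 ?(ltW v0) // v4.
  apply: (@le_trans _ _ K.+1%:R); first exact/ltW/truncnS_gt.
  by rewrite /N -natrX ler_nat; apply: leq_trans mK _; apply: ltnW; exact: ltn_expl.
have lnN : ln N <= 4 * v.
  rewrite -v4 lnXn // -[X in X <= _]mulr_natl ler_wpM2l //.
  exact/ltW/ln_sublinear.
apply: (@le_trans _ _ (v ^+ 2)).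
  apply: (@le_trans _ _ (u * (4 * v))); first by rewrite ler_wpM2l.
  by rewrite mulrCA mulrA expr2 ler_wpM2r // ltW.
rewrite -powR_mulrn ?(ltW v0) // /v -powRrM; apply: ler_powR => //.
have d2 : (d%:R^-1 : R) <= 2^-1 by rewrite lef_pV2 ?posrE ?ltr0n ?ler_nat //; lia.
lra.
Qed.

Lemma power_tail_small (R : realType) (d : nat) (K eps : R) :
  (0 < d)%N -> 0 < K -> 0 < eps -> exists2 u, 1 <= u & K * u ^- d <= eps.
Proof.
move=> d0 K0 e0; have Ke : 0 < K / eps by rewrite divr_gt0.
exists (1 + K / eps); first by rewrite lerDl ltW.
rewrite ler_pdivrMr; last by rewrite exprn_gt0 // addr_gt0.
rewrite -ler_pdivrMl // mulrC; apply: (@le_trans _ _ (1 + K / eps)).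
  by rewrite lerDr.
by rewrite ler_eXnr // lerDl ltW.
Qed.

Section Asymptotics.
Context (R : realType) (disp : measure_display) (Omega : measurableType disp).
Variables (P : probability Omega R) (d t m : nat) (C : generators d m) (A : R).
Hypotheses (d_gt0 : (0 < d)%N) (m_ge : (maxn t 1 <= m)%N) (A_ge0 : 0 <= A).
Hypothesis net : digital_net t C.
Hypothesis coinc : coincidence_bound C A.
Let N : R := 2 ^+ m.
Variables (L : Omega -> 'I_d -> nat -> nat -> 'F_2)
  (delta : Omega -> 'I_d -> nat -> 'F_2) (K u : R).
Hypothesis scrL : matrix_scrambling P L.
Hypothesis mdelta : forall j r, measurable_digit (fun w => delta w j r).
Hypotheses (u_ge1 : 1 <= u) (u_small : u * ln N <= N `^ (1 - d%:R^-1)).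
Hypothesis K_ge : 2 ^+ t.+3 + A * 12 ^+ d <= K.
Let x w := scrambled_points R C (L w) (delta w).

Let m_gt0 : (0 < m)%N. Proof. by move: m_ge; rewrite geq_max => /andP[]. Qed.
Let u_gt0 : 0 < u. Proof. exact: lt_le_trans u_ge1. Qed.

(** The event is the one bounded in [R_inf_tail], since [1 / 0] is infinite. *)
Lemma R_inf_ratio_tail :
  (P [set w | ((2 * u * 1)%:E
        < `|(N `^ (- d%:R^-1) * (ln N)^-1)%:E / (R_inf (x w))%:E|)%E]
   <= (K * u ^- d)%:E)%E.
Proof.
have l0 := @ln_pow2_gt0 R m m_gt0.
have s0 : 0 < N `^ (- d%:R^-1) by apply: powR_gt0; rewrite exprn_gt0.
have t3 : 0 <= 2 ^+ t.+3 :> R by rewrite exprn_ge0.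
rewrite [X in P X](_ : _ = [set w | R_inf (x w)
    < 2^-1 * N `^ (- d%:R^-1) * (u * ln N)^-1]).
  apply: le_trans (R_inf_tail d_gt0 m_ge A_ge0 coinc scrL mdelta u_ge1 u_small) _.
  rewrite lee_fin ler_wpM2r ?invr_ge0 ?exprn_ge0 ?(ltW u_gt0) //.
  by apply: le_trans K_ge; rewrite lerDr.
set s := N `^ _ in s0 *.
have a0 : 0 < s * (ln N)^-1 by rewrite mulr_gt0 ?invr_gt0.
have -> : 2^-1 * s * (u * ln N)^-1 = s * (ln N)^-1 / (2 * u * 1).
  by field; rewrite ?gt_eqF.
have swap (a b c : R) : 0 < b -> 0 < c -> (b < a / c) = (c < a / b).
  by move=> b0 c0; rewrite ltr_pdivlMr // [RHS]ltr_pdivlMr // mulrC.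
apply/seteqP; split=> w /=; have := R_inf_ge0 (x w) (two_columns m_gt0).
  rewrite le_eqVlt => /orP[/eqP <- _|R0]; first by apply: divr_gt0 => //; rewrite !mulr_gt0.
  rewrite inver gt_eqF // -EFinM /= lte_fin ger0_norm; last first.
    by rewrite divr_ge0 ?ltW.
  by rewrite swap ?mulr_gt0.
rewrite le_eqVlt => /orP[/eqP <- _|R0].
  by rewrite inver eqxx gt0_muley ?lte_fin //= ltry.
rewrite inver gt_eqF // -EFinM /= lte_fin ger0_norm; last first.
  by rewrite divr_ge0 ?ltW.
by rewrite swap ?mulr_gt0.
Qed.

Lemma rho_inf_abs_tail :
  (P [set w | ((K * u * ln N)%:E < `|rho_inf (x w)|)%E] <= (K * u ^- d)%:E)%E.
Proof.
have xrho w : (`|rho_inf (x w)| = rho_inf (x w))%E.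
  apply/gee0_abs; rewrite /rho_inf; case: ifP => // _.
  by rewrite lee_fin divr_ge0 ?mulr_ge0 ?(h_inf_ge0 _ 0) ?(R_inf_ge0 _ (two_columns m_gt0)).
have -> : [set w | ((K * u * ln N)%:E < `|rho_inf (x w)|)%E]
    = [set w | ((K * u * ln N)%:E < rho_inf (x w))%E].
  by apply/seteqP; split=> w /=; rewrite xrho.
apply: le_trans (scrambled_tail d_gt0 m_ge A_ge0 net coinc scrL mdelta u_ge1 u_small K_ge).
apply: le_measure; rewrite ?inE.
- exact: (measurable_rho_inf_scrambled C m_gt0 scrL mdelta).
- apply: measurableU; last exact: (measurable_rho_inf_scrambled C m_gt0 scrL mdelta).
  by apply: measurable_lt_set => //; exact: (measurable_R_inf_scrambled C m_gt0 scrL mdelta).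
- by move=> w big; right.
Qed.

End Asymptotics.

Theorem theorem5p5 (R : realType) (d t : nat) (A : R)
    (hd : (2 <= d)%N) (hA : 1 <= A) :
  let N (m : nat) : R := 2 ^+ m in
  exists c C : R, [/\ 0 < c, 0 < C &
  forall G : forall m : nat, generators d m,
    (forall m, (maxn t 1 <= m)%N -> digital_net t (G m)) ->
    (forall m, (maxn t 1 <= m)%N -> coincidence_bound (G m) A) ->
  forall (disp : measure_display) (Omega : measurableType disp)
    (P : probability Omega R),
  [/\
    (* tail bound, matrix scrambling *)
    forall (m : nat) (u : R), (maxn t 1 <= m)%N -> 1 <= u ->
      u * ln (N m) <= N m `^ (1 - d%:R^-1) ->
      forall (L : Omega -> 'I_d -> nat -> nat -> 'F_2)
        (delta : 'I_d -> nat -> 'F_2),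
      matrix_scrambling P L ->
      let x w := scrambled_points R (G m) (L w) delta in
      (P [set w | (R_inf (x w) < c * N m `^ (- d%:R^-1) * (u * ln (N m))^-1)%R
                  \/ (C * u * ln (N m))%:E < rho_inf (x w)]
       <= (C * u ^- d)%:E)%E,
    (* tail bound, linear scrambling *)
    forall (m : nat) (u : R), (maxn t 1 <= m)%N -> 1 <= u ->
      u * ln (N m) <= N m `^ (1 - d%:R^-1) ->
      forall (L : Omega -> 'I_d -> nat -> nat -> 'F_2)
        (delta : Omega -> 'I_d -> nat -> 'F_2),
      linear_scrambling P L delta ->
      let x w := scrambled_points R (G m) (L w) (delta w) in
      (P [set w | (R_inf (x w) < c * N m `^ (- d%:R^-1) * (u * ln (N m))^-1)%R
                  \/ (C * u * ln (N m))%:E < rho_inf (x w)]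
       <= (C * u ^- d)%:E)%E,
    (* asymptotics, matrix scrambling, uniformly over the shift *)
    forall L : nat -> Omega -> 'I_d -> nat -> nat -> 'F_2,
      (forall m, matrix_scrambling P (L m)) ->
      let x delta m w := scrambled_points R (G m) (L m w) delta in
      unif_bigOmega_prob P
        (fun (delta : 'I_d -> nat -> 'F_2) m w => (R_inf (x delta m w))%:E)
        (fun m => N m `^ (- d%:R^-1) * (ln (N m))^-1)
      /\ unif_bigO_prob P
        (fun (delta : 'I_d -> nat -> 'F_2) m w => rho_inf (x delta m w))
        (fun m => ln (N m))
    & (* asymptotics, linear scrambling *)
    forall (L : nat -> Omega -> 'I_d -> nat -> nat -> 'F_2)
      (delta : nat -> Omega -> 'I_d -> nat -> 'F_2),
      (forall m, linear_scrambling P (L m) (delta m)) ->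
      let x m w := scrambled_points R (G m) (L m w) (delta m w) in
      bigOmega_prob P (fun m w => (R_inf (x m w))%:E)
        (fun m => N m `^ (- d%:R^-1) * (ln (N m))^-1)
      /\ bigO_prob P (fun m w => rho_inf (x m w)) (fun m => ln (N m))]].
Proof.
move=> N; have A0 : 0 <= A by exact: le_trans hA.
have d0 : (0 < d)%N by exact: leq_trans hd.
pose K : R := 2 ^+ t.+3 + A * 12 ^+ d.
have K0 : 0 < K by rewrite ltr_wpDr ?exprn_gt0 ?mulr_ge0 ?exprn_ge0.
exists 2^-1, K; split=> //.
move=> G net coinc disp Omega P.
have mcst (delta : 'I_d -> nat -> 'F_2) j r : measurable_digit (fun _ : Omega => delta j r).
  exact: measurable_digit_cst.
(* The scale on which both asymptotic statements hold with error [eps]. *)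
have scale eps : 0 < eps -> exists u, [/\ 1 <= u, K * u ^- d <= eps
    & exists m0, forall m, (m0 <= m)%N -> (maxn t 1 <= m)%N
        /\ u * ln (N m) <= N m `^ (1 - d%:R^-1)].
  move=> eps0; have [u u1 ueps] := power_tail_small d0 K0 eps0.
  exists u; split=> //; apply: eventually_small => //; exact: le_trans u1.
split.
- move=> m u mt u1 small L delta scrL /=.
  exact: (scrambled_tail d0 mt A0 (net m mt) (coinc m mt) scrL (mcst delta) u1 small).
- move=> m u mt u1 small L delta /linear_scrambling_matrix[scrL mdelta] /=.
  exact: (scrambled_tail d0 mt A0 (net m mt) (coinc m mt) scrL mdelta u1 small).
- move=> L scrL x; split=> eps eps0;
    have [u [u1 ueps [m0 m0P]]] := scale eps eps0; have u0 := lt_le_trans ltr01 u1.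
    exists (2 * u); first by rewrite mulr_gt0.
    exists m0 => m /m0P[mt small] delta; apply: le_trans (_ : (K * u ^- d)%:E <= _)%E => //.
    exact: (R_inf_ratio_tail d0 mt A0 (coinc m mt) (scrL m) (mcst delta) u1 small (lexx K)).
  exists (K * u); first by rewrite mulr_gt0.
  exists m0 => m /m0P[mt small] delta; apply: le_trans (_ : (K * u ^- d)%:E <= _)%E => //.
  exact: (rho_inf_abs_tail d0 mt A0 (net m mt) (coinc m mt) (scrL m) (mcst delta)
    u1 small (lexx K)).
- move=> L delta lin x; split=> eps eps0;
    have [u [u1 ueps [m0 m0P]]] := scale eps eps0; have u0 := lt_le_trans ltr01 u1.
    exists (2 * u); first by rewrite mulr_gt0.
    exists m0 => m /m0P[mt small]; apply: le_trans (_ : (K * u ^- d)%:E <= _)%E => //.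
    have [scrL mdelta] := linear_scrambling_matrix (lin m).
    exact: (R_inf_ratio_tail d0 mt A0 (coinc m mt) scrL mdelta u1 small (lexx K)).
  exists (K * u); first by rewrite mulr_gt0.
  exists m0 => m /m0P[mt small]; apply: le_trans (_ : (K * u ^- d)%:E <= _)%E => //.
  have [scrL mdelta] := linear_scrambling_matrix (lin m).
  exact: (rho_inf_abs_tail d0 mt A0 (net m mt) (coinc m mt) scrL mdelta u1 small (lexx K)).
Qed.
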